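(* Let $B$ be the algebra with $D(\mathfrak{D}_4)$-action described in the context (the case $(\alpha,\beta,\gamma,u_1,u_2,u_3,u_4)=(1,1,-1,1,1,1,1)$). Then the following seventeen elements minimally generate the invariant subring $B^{D(\mathfrak{D}_4)}$ as a $\Bbbk$-algebra: $g_1=y_1y_2$, $g_2=z_1z_2$, $g_3=x_1^2x_2^2$, $g_4=x_1^4+x_2^4$, $g_5=y_1^4+y_2^4$, $g_6=z_1^4+z_2^4$, $g_7=(x_1^2-x_2^2)(y_1^2-y_2^2)$, $g_8=(x_1^2+x_2^2)(z_1^2-z_2^2)$, $g_9=(x_1x_2)(x_1^4-x_2^4)$, $g_{10}=(x_1x_2)(x_1^2+x_2^2)(y_1^2-y_2^2)$, $g_{11}=(x_1x_2)(x_1^2-x_2^2)(z_1^2-z_2^2)$, $g_{12}=(x_1x_2)(y_1^2z_1^2+y_2^2z_2^2)$, $g_{13}=(x_1x_2)(y_1^2z_2^2+y_2^2z_1^2)$, $g_{14}=(x_1^4-x_2^4)(y_1^2z_2^2+y_2^2z_1^2)$, $g_{15}=(x_1^2+x_2^2)(y_1^4z_2^2-y_2^4z_1^2)$, $g_{16}=(x_1^2-x_2^2)(y_1^2z_2^4-y_2^2z_1^4)$, $g_{17}=y_1^4z_2^4+y_2^4z_1^4$.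
   Context: Let $\Bbbk=\mathbb{C}$, $i=\sqrt{-1}$, $\mathfrak{D}_4=\langle r,s\mid r^4=e,\ s^2=r^2,\ rsrs^{-1}=e\rangle$. The Drinfeld double $D(G)$ has basis $\{\phi_gh\}$, multiplication $(\phi_g h)(\phi_{g'}h')=\delta_{g,hg'h^{-1}}\phi_g hh'$, comultiplication $\Delta(\phi_gh)=\sum_x\phi_xh\otimes\phi_{x^{-1}g}h$, counit $\epsilon(\phi_gh)=\delta_{g,e}$. A right $D(G)$-module algebra is a $G$-graded algebra with a right $G$-action by algebra automorphisms with $A_x\cdot g\subseteq A_{g^{-1}xg}$, $\phi_x$ projecting onto $A_x$; the invariant subring $A^{D(G)}=\{a:a\cdot h=\epsilon(h)a\ \forall h\}$ consists of the $G$-fixed elements of $A_e$. $B$ is the quotient of $\Bbbk\langle x_1,x_2,y_1,y_2,z_1,z_2\rangle$ by the relations $x_1x_2-x_2x_1$, $y_1y_2-y_2y_1$, $z_1z_2+z_2z_1$, $x_2y_1-y_1x_1$, $x_1y_2+y_2x_2$, $x_2y_2+y_2x_1$, $x_1y_1-y_1x_2$, $x_2z_1-iz_1x_1$, $ix_1z_2-z_2x_2$, $ix_2z_2-z_2x_1$, $x_1z_1-iz_1x_2$, $y_2z_1-z_1y_2$, $y_1z_2-z_2y_1$, $y_1z_1-z_1y_1$, $y_2z_2-z_2y_2$. The $D(\mathfrak{D}_4)$-module algebra structure is given on generators by: $x_1$: grade $s$, $x_1\cdot r=x_2$, $x_1\cdot s=-ix_1$; $x_2$: grade $sr^2$, $x_2\cdot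 r=-x_1$, $x_2\cdot s=ix_2$; $y_1$: grade $sr$, $y_1\cdot r=-y_2$, $y_1\cdot s=y_2$; $y_2$: grade $sr^3$, $y_2\cdot r=-y_1$, $y_2\cdot s=y_1$; $z_1$: grade $sr$, $z_1\cdot r=-iz_2$, $z_1\cdot s=z_2$; $z_2$: grade $sr^3$, $z_2\cdot r=-iz_1$, $z_2\cdot s=-z_1$. *)

(* Defs.v *)
From HB Require Import structures.
From mathcomp Require Import all_boot all_algebra.
From mathcomp Require Import complex.
From mathcomp Require Import Rstruct.

Set Implicit Arguments.
Unset Strict Implicit.
Unset Printing Implicit Defensive.

Import GRing.Theory.
Local Open Scope ring_scope.

Definition CC : fieldType := (Rdefinitions.R)[i].
Definition imag : CC := Complex 0 1.

Inductive term (V : Type) : Type :=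
| TC : CC -> term V
| TV : V -> term V
| TAdd : term V -> term V -> term V
| TMul : term V -> term V -> term V.
Arguments TC {V} _.
Arguments TV {V} _.

Definition TNeg {V} (t : term V) : term V := TMul (TC (-1)) t.
Definition TSub {V} (t u : term V) : term V := TAdd t (TNeg u).
Fixpoint TPow {V} (t : term V) (n : nat) : term V :=
  match n with 0 => TC 1 | n'.+1 => TMul t (TPow t n') end.

Fixpoint subst {V W} (f : V -> term W) (t : term V) : term W :=
  match t with
  | TC c => TC c
  | TV v => f v
  | TAdd a b => TAdd (subst f a) (subst f b)
  | TMul a b => TMul (subst f a) (subst f b)
  end.

(* The congruence on terms generated by the axioms of a unital associative
   CC-algebra together with the relations  r = 0  for every r with  rel r.
   Terms modulo  alg_eq rel  form exactly the quotient of the free algebra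
   CC<V> by the two-sided ideal generated by the relations. *)
Inductive alg_eq {V} (rel : term V -> Prop) : term V -> term V -> Prop :=
| ae_refl t : alg_eq rel t t
| ae_sym t u : alg_eq rel t u -> alg_eq rel u t
| ae_trans t u w : alg_eq rel t u -> alg_eq rel u w -> alg_eq rel t w
| ae_add t t' u u' : alg_eq rel t t' -> alg_eq rel u u' ->
    alg_eq rel (TAdd t u) (TAdd t' u')
| ae_mul t t' u u' : alg_eq rel t t' -> alg_eq rel u u' ->
    alg_eq rel (TMul t u) (TMul t' u')
| ae_addA t u w : alg_eq rel (TAdd t (TAdd u w)) (TAdd (TAdd t u) w)
| ae_addC t u : alg_eq rel (TAdd t u) (TAdd u t)
| ae_add0 t : alg_eq rel (TAdd t (TC 0)) t
| ae_addN t : alg_eq rel (TAdd t (TNeg t)) (TC 0)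
| ae_mulA t u w : alg_eq rel (TMul t (TMul u w)) (TMul (TMul t u) w)
| ae_mul1l t : alg_eq rel (TMul (TC 1) t) t
| ae_mul1r t : alg_eq rel (TMul t (TC 1)) t
| ae_mulDl t u w : alg_eq rel (TMul (TAdd t u) w) (TAdd (TMul t w) (TMul u w))
| ae_mulDr t u w : alg_eq rel (TMul t (TAdd u w)) (TAdd (TMul t u) (TMul t w))
| ae_cadd a b : alg_eq rel (TC (a + b)) (TAdd (TC a) (TC b))
| ae_cmul a b : alg_eq rel (TC (a * b)) (TMul (TC a) (TC b))
| ae_central a t : alg_eq rel (TMul (TC a) t) (TMul t (TC a))
| ae_rel r : rel r -> alg_eq rel r (TC 0).

Definition x1 : term 'I_6 := TV (@Ordinal 6 0 isT).
Definition x2 : term 'I_6 := TV (@Ordinal 6 1 isT).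
Definition y1 : term 'I_6 := TV (@Ordinal 6 2 isT).
Definition y2 : term 'I_6 := TV (@Ordinal 6 3 isT).
Definition z1 : term 'I_6 := TV (@Ordinal 6 4 isT).
Definition z2 : term 'I_6 := TV (@Ordinal 6 5 isT).

Declare Scope tm_scope.
Delimit Scope tm_scope with tm.
Notation "a + b" := (TAdd a b) : tm_scope.
Notation "a - b" := (TSub a b) : tm_scope.
Notation "a * b" := (TMul a b) : tm_scope.
Notation "a ^ n" := (TPow a n) : tm_scope.
Notation "c *: a" := (TMul (TC c) a) : tm_scope.

Local Open Scope tm_scope.

Definition B_rels : seq (term 'I_6) :=
  [:: x1*x2 - x2*x1; y1*y2 - y2*y1; z1*z2 + z2*z1;
      x2*y1 - y1*x1; x1*y2 + y2*x2; x2*y2 + y2*x1; x1*y1 - y1*x2;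
      x2*z1 - imag *: (z1*x1); imag *: (x1*z2) - z2*x2;
      imag *: (x2*z2) - z2*x1; x1*z1 - imag *: (z1*x2);
      y2*z1 - z1*y2; y1*z2 - z2*y1; y1*z1 - z1*y1; y2*z2 - z2*y2].

Definition B_rel (r : term 'I_6) : Prop := List.In r B_rels.

Definition eqB : term 'I_6 -> term 'I_6 -> Prop := alg_eq B_rel.

(* The group D_4 = <r, s | r^4 = e, s^2 = r^2, r s r s^{-1} = e>, of order 8.
   Its elements are written uniquely as r^a s^b (a < 4, b : bool) and encoded
   as the pair (a, b).  From r s r s^{-1} = e we get s r = r^{-1} s, and
   s^2 = r^2. *)
Definition grp := (nat * bool)%type.
Definition g_e : grp := (0%N, false).
Definition gmul (g h : grp) : grp :=
  let: (a, b) := g in let: (c, d) := h in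
  (((a + (if b then 3 * c else c) + (if b && d then 2 else 0)) %% 4)%N, xorb b d).

(* Degrees: x1 : s, x2 : s r^2 = r^2 s, y1 : s r = r^3 s, y2 : s r^3 = r s,
   z1 : s r = r^3 s, z2 : s r^3 = r s. *)
Definition gen_deg (j : 'I_6) : grp :=
  match val j with
  | 0 => (0%N, true) | 1 => (2%N, true) | 2 => (3%N, true)
  | 3 => (1%N, true) | 4 => (3%N, true) | _ => (1%N, true)
  end.

Inductive homog : grp -> term 'I_6 -> Prop :=
| hom_c c : homog g_e (TC c)
| hom_v j : homog (gen_deg j) (TV j)
| hom_add g t u : homog g t -> homog g u -> homog g (TAdd t u)
| hom_mul g h t u : homog g t -> homog h u -> homog (gmul g h) (TMul t u).

Definition in_Be (t : term 'I_6) : Prop := exists u, eqB t u /\ homog g_e u.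

Definition act_r_gen (j : 'I_6) : term 'I_6 :=
  match val j with
  | 0 => x2 | 1 => TNeg x1 | 2 => TNeg y2 | 3 => TNeg y1
  | 4 => (- imag) *: z2 | _ => (- imag) *: z1
  end.
Definition act_s_gen (j : 'I_6) : term 'I_6 :=
  match val j with
  | 0 => (- imag) *: x1 | 1 => imag *: x2 | 2 => y2 | 3 => y1
  | 4 => z2 | _ => TNeg z1
  end.
Definition act_r : term 'I_6 -> term 'I_6 := subst act_r_gen.
Definition act_s : term 'I_6 -> term 'I_6 := subst act_s_gen.

(* Right action of the group element r^a s^b:  t . (r^a s^b) = ((t . r) ... . r) . s^b *)
Definition Dact (g : grp) (t : term 'I_6) : term 'I_6 :=
  iter (nat_of_bool g.2) act_s (iter g.1 act_r t).

Definition Binv (t : term 'I_6) : Prop :=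
  in_Be t /\ forall (a : 'I_4) (b : bool), eqB (Dact (val a, b) t) t.

Definition g_list : seq (term 'I_6) :=
  [:: y1*y2;
      z1*z2;
      x1^2 * x2^2;
      x1^4 + x2^4;
      y1^4 + y2^4;
      z1^4 + z2^4;
      (x1^2 - x2^2) * (y1^2 - y2^2);
      (x1^2 + x2^2) * (z1^2 - z2^2);
      (x1*x2) * (x1^4 - x2^4);
      (x1*x2) * (x1^2 + x2^2) * (y1^2 - y2^2);
      (x1*x2) * (x1^2 - x2^2) * (z1^2 - z2^2);
      (x1*x2) * (y1^2 * z1^2 + y2^2 * z2^2);
      (x1*x2) * (y1^2 * z2^2 + y2^2 * z1^2);
      (x1^4 - x2^4) * (y1^2 * z2^2 + y2^2 * z1^2);
      (x1^2 + x2^2) * (y1^4 * z2^2 - y2^4 * z1^2);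
      (x1^2 - x2^2) * (y1^2 * z2^4 - y2^2 * z1^4);
      y1^4 * z2^4 + y2^4 * z1^4].

Definition gelt (j : 'I_17) : term 'I_6 := nth (TC 0) g_list j.

Definition generates_invariants {I : Type} (f : I -> term 'I_6) : Prop :=
  forall t, Binv t -> exists p : term I, eqB t (subst f p).

(* Main.v *)
(* The relations of B only swap letters up to powers of i, so B is spanned by the PBW
   monomials x1^a1 x2^a2 y1^b1 y2^b2 z1^c1 z2^c2.  The Reynolds operator turns an invariant
   into a combination of images of monomials of degree e.  Such an image vanishes unless the
   numbers of x's, of y's and of z's are all even; dividing by g_1, g_2, g_3 and eliminating
   high powers with g_4, g_5, g_6 then leaves finitely many monomials, for which an explicit
   expression in the g_j is checked by computation.

   For minimality, each g_j is separated from the words of the same total degree in the other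
   generators by a linear functional given by coefficients of PBW monomials.  These
   coefficients are well defined because B acts on the functions on the set of monomials, by
   the transpose of right multiplication. *)

From HB Require Import structures.
Require Import Defs.
From mathcomp Require Import all_boot all_algebra.
From mathcomp Require Import complex Rstruct boolp generic_quotient zify ring.

Set Implicit Arguments.
Unset Strict Implicit.
Unset Printing Implicit Defensive.
Import GRing.Theory Num.Theory.
Local Open Scope ring_scope.

Lemma imag_sqr : imag * imag = -1.
Proof. exact: (sqr_i Rdefinitions.R). Qed.

Lemma imag_exp4 n : imag ^+ (4 * n) = 1.
Proof.
by rewrite exprM (_ : imag ^+ 4 = 1) ?expr1n // !exprS expr0 mulr1 mulrA imag_sqr mulrNN mulr1.
Qed.

(** * Evaluation of terms and PBW monomials *)

Section Evaluation.
Variables (Q : pzRingType) (k : {rmorphism CC -> Q}).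

Fixpoint eval (V : Type) (h : V -> Q) (t : term V) : Q :=
  match t with
  | TC c => k c
  | TV v => h v
  | TAdd a b => eval h a + eval h b
  | TMul a b => eval h a * eval h b
  end.

Lemma eval_neg V (h : V -> Q) t : eval h (TNeg t) = - eval h t.
Proof. by rewrite /= rmorphN1 mulN1r. Qed.

Lemma eval_sub V (h : V -> Q) t u : eval h (TSub t u) = eval h t - eval h u.
Proof. by rewrite -eval_neg. Qed.

Lemma eval_subst V W (f : V -> term W) (h : W -> Q) t :
  eval h (subst f t) = eval (fun v => eval h (f v)) t.
Proof. by elim: t => //= a -> b ->. Qed.

Hypothesis k_central : forall c q, k c * q = q * k c.

(** The universal property of the algebra presented by [rel]: an assignment of the variables that
    kills the relations factors through [alg_eq]. Centrality of [k] accounts for [ae_central]. *)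
Lemma eval_sound V (rel : term V -> Prop) (h : V -> Q) t u :
  (forall r, rel r -> eval h r = 0) -> alg_eq rel t u -> eval h t = eval h u.
Proof.
move=> hrel; elim=> {t u} //=.
- by move=> t u w _ -> _ ->.
- by move=> t t' u u' _ -> _ ->.
- by move=> t t' u u' _ -> _ ->.
- by move=> *; rewrite addrA.
- by move=> *; rewrite addrC.
- by move=> *; rewrite rmorph0 addr0.
- by move=> *; rewrite rmorphN1 mulN1r subrr rmorph0.
- by move=> *; rewrite mulrA.
- by move=> *; rewrite rmorph1 mul1r.
- by move=> *; rewrite rmorph1 mulr1.
- by move=> *; rewrite mulrDl.
- by move=> *; rewrite mulrDr.
- by move=> *; rewrite rmorphD.
- by move=> *; rewrite rmorphM.
- by move=> r /hrel ->; rewrite rmorph0.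
Qed.

End Evaluation.

(** * PBW monomials, given by the exponents of x1, x2, y1, y2, z1, z2 *)

Definition mono := (nat * nat * nat * nat * nat * nat)%type.

(* [mulv m v = (w, m')] encodes the identity [m * v = i^w m'] between PBW monomials. *)
Definition mulv (m : mono) (v : 'I_6) : nat * mono :=
  let: (a1, a2, b1, b2, c1, c2) := m in
  let w := (c2 + 3 * c1 + 2 * b2)%N in
  let o := odd b1 (+) odd b2 (+) odd c1 (+) odd c2 in
  match val v with
  | 0 => (w, if o then (a1, a2.+1, b1, b2, c1, c2) else (a1.+1, a2, b1, b2, c1, c2))
  | 1 => (w, if o then (a1.+1, a2, b1, b2, c1, c2) else (a1, a2.+1, b1, b2, c1, c2))
  | 2 => (0, (a1, a2, b1.+1, b2, c1, c2))
  | 3 => (0, (a1, a2, b1, b2.+1, c1, c2))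
  | 4 => (2 * c2, (a1, a2, b1, b2, c1.+1, c2))
  | _ => (0, (a1, a2, b1, b2, c1, c2.+1))
  end%N.

Definition lx1 : 'I_6 := @Ordinal 6 0 isT.
Definition lx2 : 'I_6 := @Ordinal 6 1 isT.
Definition ly1 : 'I_6 := @Ordinal 6 2 isT.
Definition ly2 : 'I_6 := @Ordinal 6 3 isT.
Definition lz1 : 'I_6 := @Ordinal 6 4 isT.
Definition lz2 : 'I_6 := @Ordinal 6 5 isT.

Lemma letterP (P : 'I_6 -> Prop) :
  P lx1 -> P lx2 -> P ly1 -> P ly2 -> P lz1 -> P lz2 -> forall v, P v.
Proof.
move=> P0 P1 P2 P3 P4 P5 v.
have -> : v = nth lx1 [:: lx1; lx2; ly1; ly2; lz1; lz2] v.
  by apply: val_inj; case: v => [[|[|[|[|[|[|]]]]]]].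
by case: v => [[|[|[|[|[|[|]]]]]]].
Qed.

Section PBW.
Variables (Q : pzRingType) (k : {rmorphism CC -> Q}) (X : 'I_6 -> Q).
Hypothesis k_central : forall c q, k c * q = q * k c.
Hypothesis X_rel : forall r, B_rel r -> eval k X r = 0.

Definition mon (m : mono) : Q :=
  let: (a1, a2, b1, b2, c1, c2) := m in
  X lx1 ^+ a1 * X lx2 ^+ a2 * X ly1 ^+ b1 * X ly2 ^+ b2 * X lz1 ^+ c1 * X lz2 ^+ c2.

Let xx (e : bool) := X (if e then lx2 else lx1).

(** Each factor [q] passed by an x exchanges x1 and x2, so the parity of [n] decides which letter
    comes out, and the scalars multiply. *)
Lemma swap_exp q w : (forall e, q * xx e = k (imag ^+ w) * (xx (~~ e) * q)) ->
  forall n e, q ^+ n * xx e = k (imag ^+ (w * n)) * (xx (e (+) odd n) * q ^+ n).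
Proof.
move=> qx; elim=> [|n IHn] e; first by rewrite muln0 !expr0 rmorph1 addbF !mul1r mulr1.
rewrite exprS -mulrA IHn !mulrA -(k_central _ q) -(mulrA (k _) q) qx.
rewrite -!mulrA -exprS !mulrA -rmorphM -exprD -mulnSr /=.
by case: e (odd n) => [] [].
Qed.

Lemma sign_exp q r : q * r = - (r * q) ->
  forall n, q ^+ n * r = k (imag ^+ (2 * n)) * (r * q ^+ n).
Proof.
move=> qr; elim=> [|n IHn]; first by rewrite muln0 !expr0 rmorph1 !mul1r mulr1.
rewrite exprS -mulrA IHn !mulrA -(k_central _ q) -(mulrA (k _) q) qr.
rewrite mulnSr exprD rmorphM -!mulrA [k (imag ^+ 2)](_ : _ = -1) ?mulN1r ?mulNr ?mulrA //.
by rewrite expr2 imag_sqr rmorphN1.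
Qed.

(** The relations of B in normal order. An x moving left through y1, y2, z1, z2 changes its index
    and costs 1, i^2, i^3, i respectively; these are the weights summed in [mulv]. *)
Lemma letters_comm :
  [/\ [/\ X lx1 * X lx2 = X lx2 * X lx1, X ly1 * X ly2 = X ly2 * X ly1
        & X lz2 * X lz1 = - (X lz1 * X lz2)],
      [/\ X lz1 * X ly1 = X ly1 * X lz1, X lz2 * X ly1 = X ly1 * X lz2,
          X lz1 * X ly2 = X ly2 * X lz1 & X lz2 * X ly2 = X ly2 * X lz2] &
      [/\ forall e, X ly1 * xx e = k (imag ^+ 0) * (xx (~~ e) * X ly1),
          forall e, X ly2 * xx e = k (imag ^+ 2) * (xx (~~ e) * X ly2),
          forall e, X lz1 * xx e = k (imag ^+ 3) * (xx (~~ e) * X lz1) &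
          forall e, X lz2 * xx e = k (imag ^+ 1) * (xx (~~ e) * X lz2)]].
Proof.
have rel j : (j < 15)%N -> eval k X (nth (TC 0) B_rels j) = 0.
  by do 15?[case: j => [_|j]; first by apply: X_rel; rewrite /B_rel /=; tauto].
have kN1 : k (-1) = -1 by rewrite rmorphN1.
have kI2 : k imag * k imag = -1 by rewrite -rmorphM imag_sqr.
move: (rel 0 isT) (rel 1 isT) (rel 2 isT) (rel 3 isT) (rel 4 isT) (rel 5 isT)
  (rel 6 isT) (rel 7 isT) (rel 8 isT) (rel 9 isT) (rel 10 isT) (rel 11 isT)
  (rel 12 isT) (rel 13 isT) (rel 14 isT); rewrite /= !kN1 !mulN1r.
rewrite -/lx1 -/lx2 -/ly1 -/ly2 -/lz1 -/lz2.
have addN (q r : Q) : q + r = 0 -> q = - r by move/eqP; rewrite addr_eq0 => /eqP.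
move=> /subr0_eq r1 /subr0_eq r2 /addN r3 /subr0_eq r4 /addN r5 /addN r6 /subr0_eq r7.
move=> /subr0_eq r8 /subr0_eq r9 /subr0_eq r10 /subr0_eq r11.
move=> /subr0_eq r12 /subr0_eq r13 /subr0_eq r14 /subr0_eq r15.
have kI3 : k (imag ^+ 3) = - k imag.
  by rewrite (exprD _ 1 2) (expr2 imag) imag_sqr mulrN1 rmorphN.
have kI q : q = - (k imag * (k imag * q)) by rewrite mulrA kI2 mulN1r opprK.
split; split=> //; first by rewrite r3 opprK.
- by case; rewrite /xx /= rmorph1 mul1r ?r7 -?r4.
- by case; rewrite /xx /= expr2 imag_sqr kN1 mulN1r ?r5 ?r6 opprK.
- by case; rewrite /xx /= kI3 mulNr ?r8 ?r11 -kI.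
- by case; rewrite /xx /= ?r9 ?r10.
Qed.

(** An x travels left through the powers of z2, z1, y2 and y1 in turn, which [movex] records. The
    other letters only pass letters with which they commute, apart from z1, which anticommutes with
    z2. *)
Lemma monM m v : mon m * X v = k (imag ^+ (mulv m v).1) * mon (mulv m v).2.
Proof.
case: m => [[[[[a1 a2] b1] b2] c1] c2].
have [[x12 y12 z21] [z1y1 z2y1 z1y2 z2y2] [y1x y2x z1x z2x]] := letters_comm.
have cX (q r : Q) n : q * r = r * q -> q ^+ n * r = r * q ^+ n.
  by move=> qr; apply/commr_sym/commrX/esym.
pose e0 := odd b1 (+) odd b2 (+) odd c1 (+) odd c2.
have movex e : mon (a1, a2, b1, b2, c1, c2) * xx e =
    k (imag ^+ (c2 + 3 * c1 + 2 * b2)) *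
    mon (mulv (a1, a2, b1, b2, c1, c2) (if e then lx2 else lx1)).2.
  have step P q w n f : (forall f, q * xx f = k (imag ^+ w) * (xx (~~ f) * q)) ->
      P * q ^+ n * xx f = k (imag ^+ (w * n)) * (P * xx (f (+) odd n) * q ^+ n).
    by move=> /swap_exp qx; rewrite -mulrA qx !mulrA k_central.
  rewrite /mon (step _ _ _ _ _ z2x) (step _ _ _ _ _ z1x) (step _ _ _ _ _ y2x).
  rewrite (step _ _ _ _ _ y1x) !mulrA -!rmorphM -!exprD mul0n addn0 mul1n.
  rewrite -!mulrA; congr (_ * _); rewrite !mulrA -!addbA.
  have -> : X lx1 ^+ a1 * X lx2 ^+ a2 = mon (a1, a2, 0, 0, 0, 0)%N.
    by rewrite /mon !expr0 !mulr1.
  have -> : e (+) (odd c2 (+) (odd c1 (+) (odd b2 (+) odd b1))) = e (+) e0.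
    by rewrite /e0; case: e (odd b1) (odd b2) (odd c1) (odd c2) => [] [] [] [] [].
  have -> : mon (a1, a2, 0, 0, 0, 0)%N * xx (e (+) e0) =
      X lx1 ^+ (a1 + ~~ (e (+) e0)) * X lx2 ^+ (a2 + (e (+) e0)).
    rewrite /mon !expr0 !mulr1 /xx; case: (e (+) e0); first by rewrite addn1 addn0 exprSr mulrA.
    by rewrite addn1 addn0 exprSr -!mulrA (cX _ _ a2 (esym x12)).
  by rewrite /e0; case: e; rewrite /mulv /=; case: (_ (+) odd c2); rewrite /= ?addn0 ?addn1.
elim/letterP: v => /=; rewrite ?expr0 ?rmorph1 ?mul1r.
- by rewrite (movex false) /mulv /=.
- by rewrite (movex true) /mulv /=.
- by rewrite -!mulrA (cX _ _ c2 z2y1) (mulrA (X lz1 ^+ _) (X ly1)) (cX _ _ c1 z1y1) -!mulrA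
     (mulrA (X ly2 ^+ _)) (cX _ _ b2 (esym y12)) exprSr !mulrA.
- by rewrite -!mulrA (cX _ _ c2 z2y2) (mulrA (X lz1 ^+ _) (X ly2)) (cX _ _ c1 z1y2) -!mulrA
     (mulrA (X ly2 ^+ _)) -exprSr !mulrA.
- rewrite -mulrA (sign_exp z21) mulrA -(k_central _ (_ * X lz1 ^+ c1)) -!mulrA.
  by rewrite (mulrA (X lz1 ^+ c1)) -exprSr.
- by rewrite exprSr !mulrA.
Qed.

End PBW.

(** * Functionals on PBW monomials *)

(* [op t f m] is [f (m * t)]: the transpose of right multiplication, acting on
   functionals given by their values on PBW monomials. *)
Fixpoint op (t : term 'I_6) (f : mono -> CC) (m : mono) : CC :=
  match t with
  | TC c => c * f m
  | TV v => imag ^+ (mulv m v).1 * f (mulv m v).2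
  | TAdd a b => op a f m + op b f m
  | TMul a b => op a (op b f) m
  end.

Lemma op_ext t f f' : f =1 f' -> op t f =1 op t f'.
Proof.
elim: t f f' => [c|v|a IHa b IHb|a IHa b IHb] f f' ff' m //=; rewrite ?ff' //.
- by rewrite (IHa _ _ ff') (IHb _ _ ff').
- by apply: IHa; apply: IHb.
Qed.

Lemma op_add t f f' m : op t (fun m => f m + f' m) m = op t f m + op t f' m.
Proof.
elim: t f f' m => [c|v|a IHa b IHb|a IHa b IHb] f f' m /=; rewrite ?mulrDr //.
- by rewrite IHa IHb addrACA.
- by rewrite -IHa; apply: op_ext => m'; apply: IHb.
Qed.

Lemma op_scale t c f m : op t (fun m => c * f m) m = c * op t f m.
Proof.
elim: t f m => [c'|v|a IHa b IHb|a IHa b IHb] f m /=; rewrite 1?mulrCA //.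
- by rewrite IHa IHb mulrDr.
- by rewrite -IHa; apply: op_ext => m'; apply: IHb.
Qed.

Lemma imag_opp m n (x : CC) :
  (m = n + 2 %[mod 4])%N -> imag ^+ m * x + imag ^+ n * x = 0.
Proof.
have red j : imag ^+ j = imag ^+ (j %% 4).
  by rewrite {1}(divn_eq j 4) exprD mulnC imag_exp4 mul1r.
by move=> mn; rewrite red mn -red exprD (expr2 imag) imag_sqr mulrN1 mulNr addNr.
Qed.

(** Once the parities of the y and z exponents are fixed, both terms of a relation lead from [m] to
    the same monomial, with powers of i whose exponents differ by 2 modulo 4, so they cancel. *)
Lemma op_rel r f m : B_rel r -> op r f m = 0.
Proof.
have iN1 : -1 = imag ^+ 2 by rewrite expr2 imag_sqr.
have i1 x : imag * x = imag ^+ 1 * x by [].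
case: m => [[[[[a1 a2] b1] b2] c1] c2].
move=> [<-|[<-|[<-|[<-|[<-|[<-|[<-|[<-|[<-|[<-|[<-|[<-|[<-|[<-|[<-|[]]]]]]]]]]]]]]]].
all: rewrite /= ?iN1 -/imag.
all: case o1: (odd b1); case o2: (odd b2); case o3: (odd c1); case o4: (odd c2).
all: rewrite /= ?o1 ?o2 ?o3 ?o4 /= ?[imag * _]i1 !mulrA -!exprD.
all: by apply: imag_opp; lia.
Qed.

(** Functionals on monomials thus form a left B-module. This is the independence half of the PBW
    theorem: an equality in B can be refuted by a coefficient. *)
Lemma op_sound t u : eqB t u -> forall f m, op t f m = op u f m.
Proof.
elim=> {t u} //=.
- by move=> t u w _ IHt _ IHu f m; rewrite IHt IHu.
- by move=> t t' u u' _ IHt _ IHu f m; rewrite IHt IHu.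
- by move=> t t' u u' _ IHt _ IHu f m; rewrite IHt; apply: op_ext.
- by move=> *; rewrite addrA.
- by move=> *; rewrite addrC.
- by move=> *; rewrite mul0r addr0.
- by move=> *; rewrite mulN1r subrr mul0r.
- by move=> *; rewrite mul1r.
- by move=> t f m; apply: op_ext => m'; rewrite mul1r.
- by move=> t u w f m; rewrite op_add.
- by move=> *; rewrite mulrDl.
- by move=> *; rewrite mulrA.
- by move=> a t f m; rewrite op_scale.
- by move=> r rr f m; rewrite op_rel ?mul0r.
Qed.

(** * The quotient ring *)

Section Quotient.
Local Open Scope quotient_scope.
Variable (V : Type) (rel : term V -> Prop).

(** The quotient construction requires a choice type and a boolean relation. Constants are complex
    numbers and [V] is arbitrary, so both are obtained classically. *)
HB.instance Definition _ := gen_eqMixin (term V).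
HB.instance Definition _ := gen_choiceMixin (term V).

Let eqb t u : bool := `[< alg_eq rel t u >].
Fact eqb_equiv : equiv_class_of eqb.
Proof.
split=> [t|t u|u t w]; first by apply/asboolP; apply: ae_refl.
  by apply/asboolP/asboolP; apply: ae_sym.
by move=> /asboolP tu /asboolP uw; apply/asboolP; apply: ae_trans tu uw.
Qed.
Canonical eqb_equiv_rel := EquivRelPack eqb_equiv.
Definition quot := {eq_quot eqb_equiv_rel}.
HB.instance Definition _ := Choice.on quot.

Definition cls (t : term V) : quot := \pi_{eq_quot eqb_equiv_rel} t.

Lemma clsP t u : cls t = cls u <-> alg_eq rel t u.
Proof. by split=> [/eqmodP/asboolP | tu]; last by apply/eqmodP/asboolP. Qed.

Lemma cls_surj q : exists t, q = cls t.
Proof. by exists (repr q); rewrite /cls reprK. Qed.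

Definition qadd (q r : quot) : quot := cls (TAdd (repr q) (repr r)).
Definition qmul (q r : quot) : quot := cls (TMul (repr q) (repr r)).
Definition qopp (q : quot) : quot := cls (TNeg (repr q)).

Lemma cls_repr t : alg_eq rel (repr (cls t)) t.
Proof. by apply/clsP; rewrite /cls reprK. Qed.

Lemma qaddE t u : qadd (cls t) (cls u) = cls (TAdd t u).
Proof. by apply/clsP/ae_add; apply: cls_repr. Qed.
Lemma qmulE t u : qmul (cls t) (cls u) = cls (TMul t u).
Proof. by apply/clsP/ae_mul; apply: cls_repr. Qed.
Lemma qoppE t : qopp (cls t) = cls (TNeg t).
Proof. by apply/clsP/ae_mul; [apply: ae_refl | apply: cls_repr]. Qed.

Lemma qaddA : associative qadd.
Proof.
move=> q r s; have [[t ->] [u ->] [w ->]] := And3 (cls_surj q) (cls_surj r) (cls_surj s).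
by rewrite !qaddE; apply/clsP/ae_addA.
Qed.
Lemma qaddC : commutative qadd.
Proof.
move=> q r; have [[t ->] [u ->]] := conj (cls_surj q) (cls_surj r).
by rewrite !qaddE; apply/clsP/ae_addC.
Qed.
Lemma qadd0 : left_id (cls (TC 0)) qadd.
Proof.
move=> q; have [t ->] := cls_surj q.
by rewrite qaddC qaddE; apply/clsP/ae_add0.
Qed.
Lemma qaddN : left_inverse (cls (TC 0)) qopp qadd.
Proof.
move=> q; have [t ->] := cls_surj q.
by rewrite qaddC qoppE qaddE; apply/clsP/ae_addN.
Qed.
HB.instance Definition _ := GRing.isZmodule.Build quot qaddA qaddC qadd0 qaddN.

Lemma qmulA : associative qmul.
Proof.
move=> q r s; have [[t ->] [u ->] [w ->]] := And3 (cls_surj q) (cls_surj r) (cls_surj s).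
by rewrite !qmulE; apply/clsP/ae_mulA.
Qed.
Lemma qmul1 : left_id (cls (TC 1)) qmul.
Proof. by move=> q; have [t ->] := cls_surj q; rewrite qmulE; apply/clsP/ae_mul1l. Qed.
Lemma qmulr1 : right_id (cls (TC 1)) qmul.
Proof. by move=> q; have [t ->] := cls_surj q; rewrite qmulE; apply/clsP/ae_mul1r. Qed.
Lemma qmulDl : left_distributive qmul +%R.
Proof.
move=> q r s; have [[t ->] [u ->] [w ->]] := And3 (cls_surj q) (cls_surj r) (cls_surj s).
by rewrite [LHS](congr1 (qmul^~ _) (qaddE _ _)) !qmulE [RHS]qaddE; apply/clsP/ae_mulDl.
Qed.
Lemma qmulDr : right_distributive qmul +%R.
Proof.
move=> q r s; have [[t ->] [u ->] [w ->]] := And3 (cls_surj q) (cls_surj r) (cls_surj s).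
by rewrite [LHS](congr1 (qmul _) (qaddE _ _)) !qmulE [RHS]qaddE; apply/clsP/ae_mulDr.
Qed.
HB.instance Definition _ :=
  GRing.Zmodule_isPzRing.Build quot qmulA qmul1 qmulr1 qmulDl qmulDr.

Definition qconst (c : CC) : quot := cls (TC c).
Fact qconst_additive : zmod_morphism qconst.
Proof.
move=> a b; rewrite -{2}(subrK b a).
have -> : qconst (a - b + b) = qconst (a - b) + qconst b.
  by rewrite [RHS]qaddE; apply/clsP/ae_cadd.
by rewrite addrK.
Qed.
Fact qconst_multiplicative : monoid_morphism qconst.
Proof. by split=> // a b; rewrite [RHS]qmulE; apply/clsP/ae_cmul. Qed.
HB.instance Definition _ := GRing.isZmodMorphism.Build CC quot qconst qconst_additive.
HB.instance Definition _ := GRing.isMonoidMorphism.Build CC quot qconst qconst_multiplicative.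

Lemma qconst_central c (q : quot) : qconst c * q = q * qconst c.
Proof.
have [t ->] := cls_surj q.
by rewrite [LHS]qmulE [RHS]qmulE; apply/clsP/ae_central.
Qed.

Lemma eval_cls t : eval qconst (fun v => cls (TV v)) t = cls t.
Proof. by elim: t => //= a -> b ->; [rewrite [LHS]qaddE | rewrite [LHS]qmulE]. Qed.

(** Reduces derivability in [alg_eq] to an equality in an actual ring, where ring lemmas apply. *)
Lemma eval_quot t u : eval qconst (fun v => cls (TV v)) t = eval qconst (fun v => cls (TV v)) u ->
  alg_eq rel t u.
Proof. by rewrite !eval_cls => /clsP. Qed.

Lemma quot_rel r : rel r -> eval qconst (fun v => cls (TV v)) r = 0.
Proof. by rewrite eval_cls => rr; apply/clsP/ae_rel. Qed.

End Quotient.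

(** * Computation with Gaussian integer coefficients *)

Definition gauss := (int * int)%type.

(* The special cases make [tr] below yield literally the constants of the
   generators and of the action. *)
Definition emb (g : gauss) : CC :=
  match g with
  | (Posz 1, Posz 0) => 1
  | (Negz 0, Posz 0) => -1
  | (Posz 0, Posz 1) => imag
  | (Posz 0, Negz 0) => - imag
  | (a, b) => a%:~R + b%:~R * imag
  end.

Lemma embE a b : emb (a, b) = a%:~R + b%:~R * imag.
Proof.
case: a b => [[|[|a]]|[|a]] [[|[|b]]|[|b]] //=;
  by rewrite -?[Negz 0]/(-1) ?mulrN1z ?mulr0z ?mulr1z ?mulN1r ?mul0r ?mul1r ?addr0 ?add0r.
Qed.

Definition gadd (g h : gauss) : gauss := (g.1 + h.1, g.2 + h.2).
Definition gmult (g h : gauss) : gauss := (g.1 * h.1 - g.2 * h.2, g.1 * h.2 + g.2 * h.1).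
Definition gi (n : nat) : gauss := iter n (gmult (0, 1)) (1, 0).

Arguments emb : simpl never.
Arguments gadd : simpl never.
Arguments gmult : simpl never.
Arguments gi : simpl never.

Lemma emb_add g h : emb (gadd g h) = emb g + emb h.
Proof. by case: g h => a b [c d]; rewrite /gadd /= !embE !rmorphD mulrDl addrACA. Qed.

Lemma emb_mul g h : emb (gmult g h) = emb g * emb h.
Proof.
case: g h => a b [c d]; rewrite /gmult /= !embE !(rmorphD, rmorphN, rmorphM) /=.
have -> (x y z w i : CC) : (x + y * i) * (z + w * i) =
    x * z + y * w * (i * i) + (x * w + y * z) * i by ring.
by rewrite imag_sqr mulrN1.
Qed.

Lemma emb_i n : emb (gi n) = imag ^+ n.
Proof. by elim: n => [|n IHn] //; rewrite [gi _]iterS emb_mul exprS -IHn. Qed.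

(** A computable copy of terms: the constants of [term] are built on the real numbers and do not
    evaluate, while Gaussian integers do. *)
Inductive zt (V : Type) : Type :=
| ZC of gauss
| ZV of V
| ZAdd of zt V & zt V
| ZMul of zt V & zt V.
Arguments ZC {V} _.

Fixpoint tr V (t : zt V) : term V :=
  match t with
  | ZC g => TC (emb g)
  | ZV v => TV v
  | ZAdd a b => TAdd (tr a) (tr b)
  | ZMul a b => TMul (tr a) (tr b)
  end.

Definition zneg V (t : zt V) : zt V := ZMul (ZC (-1, 0)) t.
Fixpoint zpow V (t : zt V) (n : nat) : zt V :=
  if n is n'.+1 then ZMul t (zpow t n') else ZC (1, 0).

Fixpoint zsubst V W (f : V -> zt W) (t : zt V) : zt W :=
  match t with
  | ZC g => ZC g
  | ZV v => f v
  | ZAdd a b => ZAdd (zsubst f a) (zsubst f b)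
  | ZMul a b => ZMul (zsubst f a) (zsubst f b)
  end.

Lemma tr_subst V W (f : V -> zt W) (h : V -> term W) t :
  (forall v, tr (f v) = h v) -> tr (zsubst f t) = subst h (tr t).
Proof. by move=> fh; elim: t => //= a -> b ->. Qed.

Definition poly := seq (gauss * mono).

(** Right multiplication of the combination [p] by [t], hence the order in the [ZMul] case. Like
    monomials are not collected here but in [is0]. *)
Fixpoint ev (t : zt 'I_6) (p : poly) : poly :=
  match t with
  | ZC g => [seq (gmult g cm.1, cm.2) | cm <- p]
  | ZV v => [seq (gmult (gi (mulv cm.2 v).1) cm.1, (mulv cm.2 v).2) | cm <- p]
  | ZAdd a b => ev a p ++ ev b p
  | ZMul a b => ev b (ev a p)
  end.

Fixpoint ins (c : gauss) (m : mono) (p : poly) : poly :=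
  if p is (c', m') :: p' then
    if m == m' then (gadd c c', m) :: p' else (c', m') :: ins c m p'
  else [:: (c, m)].
Definition is0 (p : poly) : bool :=
  all (fun cm => cm.1 == (0, 0)) (foldr (fun cm => ins cm.1 cm.2) [::] p).

Definition pone : poly := [:: ((1, 0), (0, 0, 0, 0, 0, 0)%N)].
Definition zeqb (t u : zt 'I_6) : bool := is0 (ev (ZAdd t (zneg u)) pone).

Section Denotation.
Variables (Q : pzRingType) (k : {rmorphism CC -> Q}).

Definition den (mn : mono -> Q) (p : poly) : Q :=
  \sum_(cm <- p) k (emb cm.1) * mn cm.2.

Lemma den_cons mn cm p : den mn (cm :: p) = k (emb cm.1) * mn cm.2 + den mn p.
Proof. by rewrite /den big_cons. Qed.

Lemma is0P mn p : is0 p -> den mn p = 0.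
Proof.
have den_ins c m q : den mn (ins c m q) = k (emb c) * mn m + den mn q.
  elim: q => [|[c' m'] q IHq] //=; first by rewrite den_cons.
  case: eqP => [->|_]; rewrite !den_cons /=; first by rewrite emb_add rmorphD mulrDl addrA.
  by rewrite IHq addrCA.
have -> : den mn p = den mn (foldr (fun cm => ins cm.1 cm.2) [::] p).
  by elim: p => //= cm p IHp; rewrite den_ins den_cons IHp.
move=> /allP p0; rewrite /den big1_seq // => -[c m] /= /p0 /eqP /= ->.
by rewrite embE mul0r addr0 rmorph0 mul0r.
Qed.

Variable X : 'I_6 -> Q.
Hypothesis k_central : forall c q, k c * q = q * k c.
Hypothesis X_rel : forall r, B_rel r -> eval k X r = 0.

Lemma den_ev t p : den (mon X) (ev t p) = den (mon X) p * eval k X (tr t).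
Proof.
elim: t p => [g|v|a IHa b IHb|a IHa b IHb] p /=.
- rewrite /den big_map mulr_suml; apply: eq_bigr => -[c m] _ /=.
  by rewrite emb_mul rmorphM -mulrA k_central.
- rewrite /den big_map mulr_suml; apply: eq_bigr => -[c m] _ /=.
  by rewrite emb_mul emb_i rmorphM -!mulrA (monM k_central X_rel) !mulrA k_central.
- by rewrite mulrDr -IHa -IHb /den big_cat.
- by rewrite IHb IHa mulrA.
Qed.

Lemma den_one : den (mon X) pone = 1.
Proof. by rewrite /pone den_cons /den big_nil /= !expr0 rmorph1 !mulr1 addr0. Qed.

Lemma zeqb_eval t u : zeqb t u -> eval k X (tr t) = eval k X (tr u).
Proof.
move/(is0P (mon X)); rewrite den_ev den_one mul1r.
by rewrite [eval _ _ _]eval_sub => /subr0_eq.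
Qed.

End Denotation.

Lemma zeqb_sound t u : zeqb t u -> eqB (tr t) (tr u).
Proof.
move=> tu; apply: eval_quot; apply: zeqb_eval tu; first exact: qconst_central.
exact: quot_rel.
Qed.

(** With [den idfun f p] read as the value of the functional [f] at [p], this says that [op] is the
    transpose of [ev]. *)
Lemma op_ev f t p : den idfun f (ev t p) = den idfun (op (tr t) f) p.
Proof.
elim: t f p => [g|v|a IHa b IHb|a IHa b IHb] f p /=.
- rewrite /den big_map; apply: eq_bigr => -[c m] _ /=.
  by rewrite emb_mul mulrCA mulrA.
- rewrite /den big_map; apply: eq_bigr => -[c m] _ /=.
  by rewrite emb_mul emb_i mulrCA !mulrA.
- rewrite /den big_cat /= [X in X + _]IHa [X in _ + X]IHb -big_split /=.
  by apply: eq_bigr => cm _; rewrite mulrDr.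
- by rewrite IHb IHa.
Qed.

Declare Scope zt_scope.
Delimit Scope zt_scope with zt.
Notation "a + b" := (ZAdd a b) : zt_scope.
Notation "a - b" := (ZAdd a (zneg b)) : zt_scope.
Notation "a * b" := (ZMul a b) : zt_scope.
Notation "a ^ n" := (zpow a n) : zt_scope.

Section Generators.
Let x1 := ZV lx1. Let x2 := ZV lx2. Let y1 := ZV ly1.
Let y2 := ZV ly2. Let z1 := ZV lz1. Let z2 := ZV lz2.
Local Open Scope zt_scope.

Definition zg_list : seq (zt 'I_6) :=
  [:: y1*y2;
      z1*z2;
      x1^2 * x2^2;
      x1^4 + x2^4;
      y1^4 + y2^4;
      z1^4 + z2^4;
      (x1^2 - x2^2) * (y1^2 - y2^2);
      (x1^2 + x2^2) * (z1^2 - z2^2);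
      (x1*x2) * (x1^4 - x2^4);
      (x1*x2) * (x1^2 + x2^2) * (y1^2 - y2^2);
      (x1*x2) * (x1^2 - x2^2) * (z1^2 - z2^2);
      (x1*x2) * (y1^2 * z1^2 + y2^2 * z2^2);
      (x1*x2) * (y1^2 * z2^2 + y2^2 * z1^2);
      (x1^4 - x2^4) * (y1^2 * z2^2 + y2^2 * z1^2);
      (x1^2 + x2^2) * (y1^4 * z2^2 - y2^4 * z1^2);
      (x1^2 - x2^2) * (y1^2 * z2^4 - y2^2 * z1^4);
      y1^4 * z2^4 + y2^4 * z1^4].
Definition zg (j : 'I_17) : zt 'I_6 := nth (ZC (0, 0)) zg_list j.

Definition zact_r (v : 'I_6) : zt 'I_6 :=
  match val v with
  | 0 => x2 | 1 => zneg x1 | 2 => zneg y2 | 3 => zneg y1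
  | 4 => ZC (0, -1) * z2 | _ => ZC (0, -1) * z1
  end.
Definition zact_s (v : 'I_6) : zt 'I_6 :=
  match val v with
  | 0 => ZC (0, -1) * x1 | 1 => ZC (0, 1) * x2 | 2 => y2 | 3 => y1
  | 4 => z2 | _ => zneg z1
  end.
Definition zDact (g : grp) (t : zt 'I_6) : zt 'I_6 :=
  iter (nat_of_bool g.2) (zsubst zact_s) (iter g.1 (zsubst zact_r) t).

Definition zrels : seq (zt 'I_6) :=
  let i := ZC (0, 1) in
  [:: x1*x2 - x2*x1; y1*y2 - y2*y1; z1*z2 + z2*z1;
      x2*y1 - y1*x1; x1*y2 + y2*x2; x2*y2 + y2*x1; x1*y1 - y1*x2;
      x2*z1 - i * (z1*x1); i * (x1*z2) - z2*x2;
      i * (x2*z2) - z2*x1; x1*z1 - i * (z1*x2);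
      y2*z1 - z1*y2; y1*z2 - z2*y1; y1*z1 - z1*y1; y2*z2 - z2*y2].

End Generators.

Lemma tr_zg j : tr (zg j) = gelt j.
Proof.
by case: j; do 17?[case=> [?|]; first reflexivity].
Qed.

Lemma tr_zDact g t : tr (zDact g t) = Dact g (tr t).
Proof.
have rE v : tr (zact_r v) = act_r_gen v by elim/letterP: v.
have sE v : tr (zact_s v) = act_s_gen v by elim/letterP: v.
have iterE f h n u : (forall v, tr (f v) = h v) ->
    tr (iter n (zsubst f) u) = iter n (subst h) (tr u).
  by move=> fh; elim: n => //= n IHn; rewrite (tr_subst _ fh) IHn.
by rewrite /zDact /Dact (iterE _ _ _ _ _ sE) (iterE _ _ _ _ _ rE).
Qed.

Lemma zrelsE : map (@tr 'I_6) zrels = B_rels.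
Proof. by []. Qed.

(** * The group action and minimality *)

Lemma In_map_tr (a : zt 'I_6 -> bool) (P : term 'I_6 -> Prop) s :
  (forall t, a t -> P (tr t)) -> all a s -> forall r, List.In r (map (@tr 'I_6) s) -> P r.
Proof. by move=> aP; elim: s => //= t s IHs /andP[/aP Pt /IHs sP] r [<-|/sP]. Qed.

Lemma subst_sound (f : 'I_6 -> term 'I_6) t u :
  (forall r, B_rel r -> eqB (subst f r) (TC 0)) -> eqB t u -> eqB (subst f t) (subst f u).
Proof.
move=> frel tu; apply: eval_quot; rewrite !eval_subst.
apply: eval_sound tu; first exact: qconst_central.
by move=> r /frel /clsP fr0; rewrite -eval_subst eval_cls fr0.
Qed.

(** Both substitutions send the fifteen relations to zero, as a computation confirms, so r and s act
    on B. *)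
Lemma act_sound t u : eqB t u -> eqB (act_r t) (act_r u) /\ eqB (act_s t) (act_s u).
Proof.
have rel0 f h : (forall v, tr (f v) = h v) ->
    all (fun r => zeqb (zsubst f r) (ZC (0, 0))) zrels ->
    forall r, B_rel r -> eqB (subst h r) (TC 0).
  move=> fh frel r; rewrite /B_rel -zrelsE; move: r; apply: (In_map_tr _ frel).
  move=> r /zeqb_sound; rewrite (tr_subst _ fh) => fr0; apply: ae_trans fr0 _.
  by rewrite /= embE mul0r addr0; apply: ae_refl.
move=> tu; split; apply: subst_sound => //.
  by apply: (@rel0 zact_r); [elim/letterP | vm_compute].
by apply: (@rel0 zact_s); [elim/letterP | vm_compute].
Qed.

Lemma Dact_sound g t u : eqB t u -> eqB (Dact g t) (Dact g u).
Proof.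
move=> tu; rewrite /Dact.
have: eqB (iter g.1 act_r t) (iter g.1 act_r u).
  by elim: g.1 => //= n IHn; have [] := act_sound IHn.
by elim: (nat_of_bool _) => //= n IHn /IHn /act_sound [].
Qed.

Fixpoint zdeg (t : zt 'I_6) : option grp :=
  match t with
  | ZC _ => Some g_e
  | ZV v => Some (gen_deg v)
  | ZAdd a b => if zdeg a == zdeg b then zdeg a else None
  | ZMul a b => if (zdeg a, zdeg b) is (Some g, Some h) then Some (gmul g h) else None
  end.

Lemma zdeg_homog t g : zdeg t = Some g -> homog g (tr t).
Proof.
elim: t g => [c|v|a IHa b IHb|a IHa b IHb] g /=.
- by case=> <-; constructor.
- by case=> <-; constructor.
- by case: eqP => // ab ag; constructor; [apply: IHa | apply: IHb; rewrite -ab].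
- case: (zdeg a) IHa => // h /(_ h erefl) ha; case: (zdeg b) IHb => // h' /(_ h' erefl) hb.
  by case=> <-; constructor.
Qed.

Definition group_elts : seq grp := [seq (a, b) | a <- iota 0 4, b <- [:: false; true]].

Lemma gelt_inv j : Binv (gelt j).
Proof.
split.
  exists (gelt j); split; first exact: ae_refl.
  rewrite -tr_zg; apply: zdeg_homog.
  have /all_nthP - /(_ (ZC (0, 0)) j) zgP : all (fun t => zdeg t == Some g_e) zg_list.
    by vm_compute.
  by apply/eqP/zgP.
move=> a b; rewrite -tr_zg -tr_zDact; apply: zeqb_sound.
have /all_nthP - /(_ (ZC (0, 0)) j) zgP :
  all (fun t => all (fun g => zeqb (zDact g t) t) group_elts) zg_list.
  by vm_compute.
have /allP := zgP (ltn_ord j); apply.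
by apply/allpairsP; exists (val a, b); split; rewrite ?mem_iota ?ltn_ord //=; case: b.
Qed.

(** * Separating each generator from the words in the others *)

Definition mdeg (m : mono) : nat := let: (a1, a2, b1, b2, c1, c2) := m in a1 + a2 + b1 + b2 + c1 + c2.

Fixpoint wdeg V (d : V -> nat) (t : zt V) : option nat :=
  match t with
  | ZC _ => Some 0%N
  | ZV v => Some (d v)
  | ZAdd a b => if wdeg d a == wdeg d b then wdeg d a else None
  | ZMul a b => if (wdeg d a, wdeg d b) is (Some n, Some p) then Some (n + p)%N else None
  end.

Lemma mdeg_mulv m v : mdeg (mulv m v).2 = (mdeg m).+1.
Proof.
case: m => [[[[[a1 a2] b1] b2] c1] c2]; elim/letterP: v => /=.
all: by try case: ifP => _ /=; lia.
Qed.

(** Right multiplication by a homogeneous [t] raises the total degree by [d], so [op] only reads [f]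
    in that degree. *)
Lemma op_wdeg t d f m : wdeg (fun _ => 1%N) t = Some d ->
  (forall m', mdeg m' = (mdeg m + d)%N -> f m' = 0) -> op (tr t) f m = 0.
Proof.
elim: t d f m => [c|v|a IHa b IHb|a IHa b IHb] d f m /=.
- by case=> <- f0; rewrite f0 ?mulr0 // addn0.
- by case=> <- f0; rewrite f0 ?mulr0 // mdeg_mulv addn1.
- by case: eqP => // ab ad f0; rewrite (IHa d) ?(IHb d) ?addr0 -?ab.
- case: (wdeg _ a) IHa => // n IHa; case: (wdeg _ b) IHb => // p IHb [dnp] f0.
  apply: (IHa n) => // m' m'n; apply: (IHb p) => // m'' m''p.
  by apply: f0; rewrite m''p m'n -dnp addnA.
Qed.

Definition tword V (h : V -> term 'I_6) (w : seq V) : term 'I_6 :=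
  foldr (fun v => TMul (h v)) (TC 1) w.

Lemma op_words V (h : V -> term 'I_6) f m p :
  (forall w, op (tword h w) f m = 0) -> op (subst h p) f m = 0.
Proof.
(* The prefix [w] closes the induction: in a product, the conclusion for the right factor [b] is the
   hypothesis on [op b f] required for the left factor. *)
move=> f0; suff op0 w : op (tword h w) (op (subst h p) f) m = 0.
  by have := op0 [::]; rewrite /= mul1r.
elim: p f f0 w => [c|v|a IHa b IHb|a IHa b IHb] f f0 w /=.
- by rewrite op_scale f0 mulr0.
- rewrite -(f0 (rcons w v)); elim: w m {f0} => [|v' w IHw] m /=.
    rewrite mul1r; apply: op_ext => m'; by rewrite mul1r.
  by apply: op_ext => m'; apply: IHw.
- by rewrite op_add IHa // IHb // addr0.
- by apply: IHa => w'; apply: IHb.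
Qed.

Definition zgn (j : nat) : zt 'I_6 := nth (ZC (0, 0)) zg_list j.
Definition zword (w : seq nat) : zt 'I_6 := foldr (fun j => ZMul (zgn j)) (ZC (1, 0)) w.
Definition gdeg (j : nat) : nat := odflt 0%N (wdeg (fun _ => 1%N) (zgn j)).

(* The words of degree [d] in the generators other than [j0]; [n] is fuel. *)
Fixpoint words (j0 n d : nat) : seq (seq nat) :=
  if d is 0 then [:: [::]] else
  if n is n'.+1 then
    flatten [seq [seq k :: w | w <- words j0 n' (d - gdeg k)]
            | k <- iota 0 17 & (k != j0) && (gdeg k <= d)%N]
  else [::].

Definition coef (l : poly) (m : mono) : gauss :=
  foldr (fun cm => gadd (if m == cm.2 then cm.1 else (0, 0))) (0, 0) l.
Definition pair_val (l p : poly) : gauss :=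
  foldr (fun cm => gadd (gmult cm.1 (coef l cm.2))) (0, 0) p.

(** At the unit monomial, [op] evaluates the functional on [t] itself, so the value is found by
    expanding [t]. *)
Lemma op_val l t : op (tr t) (fun m => emb (coef l m)) (0, 0, 0, 0, 0, 0)%N =
  emb (pair_val l (ev t pone)).
Proof.
have emb0 : emb (0, 0) = 0 by rewrite embE mul0r addr0.
have -> : emb (pair_val l (ev t pone)) = den idfun (fun m => emb (coef l m)) (ev t pone).
  elim: (ev t pone) => [|cm p IHp]; first by rewrite /den big_nil emb0.
  by rewrite den_cons /= emb_add emb_mul IHp.
by rewrite op_ev /pone den_cons /den big_nil /= mul1r addr0.
Qed.

(* The [j]-th polynomial, read as a combination of coefficient functionals, takes the value 1
   at the [j]-th generator and vanishes at the words of the same degree in the others. *)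
Definition separators : seq poly :=
  let o : gauss := (1, 0) in let n : gauss := (-1, 0) in
  [:: [:: (o, (0,0,1,1,0,0))]; [:: (o, (0,0,0,0,1,1))]; [:: (o, (2,2,0,0,0,0))];
      [:: (o, (0,4,0,0,0,0))]; [:: (o, (0,0,0,4,0,0))]; [:: (o, (0,0,0,0,0,4))];
      [:: (o, (0,2,0,2,0,0))]; [:: (n, (0,2,0,0,0,2))]; [:: (n, (1,5,0,0,0,0))];
      [:: (n, (1,3,0,2,0,0))]; [:: (o, (1,3,0,0,0,2))]; [:: (o, (1,1,0,2,0,2))];
      [:: (o, (1,1,0,2,2,0))]; [:: (n, (0,4,0,2,0,2)); (n, (0,4,0,2,2,0))];
      [:: (n, (0,2,0,4,0,2)); (n, (0,2,0,4,2,0))];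
      [:: (n, (0,2,0,2,0,4)); (o, (0,2,0,2,4,0))];
      [:: (n, (0,0,0,4,0,4)); (o, (0,0,0,4,4,0))]]%N.

(** The last condition confines the functional to the degree of the generator, which disposes of the
    words of all other degrees. *)
Definition separates (j0 : nat) : bool :=
  let l := nth [::] separators j0 in
  [&& all (fun w => pair_val l (ev (zword w) pone) == (0, 0)) (words j0 (gdeg j0) (gdeg j0)),
      pair_val l (ev (zgn j0) pone) == (1, 0) &
      all (fun cm => mdeg cm.2 == gdeg j0) l].

Lemma all_separates : all separates (iota 0 17).
Proof. by vm_compute. Qed.

Lemma gdegP k : (k < 17)%N -> (0 < gdeg k)%N /\ wdeg (fun _ => 1%N) (zgn k) = Some (gdeg k).
Proof.
have /allP gdeg_ok : all (fun k => (0 < gdeg k)%N &&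
    (wdeg (fun _ => 1%N) (zgn k) == Some (gdeg k))) (iota 0 17) by vm_compute.
by move=> k17; have := gdeg_ok k; rewrite mem_iota => /(_ k17) /andP[? /eqP].
Qed.

Arguments gdeg : simpl never.

Lemma words_S j0 n d : words j0 n.+1 d.+1 =
  flatten [seq [seq k :: w | w <- words j0 n (d.+1 - gdeg k)]
          | k <- iota 0 17 & (k != j0) && (gdeg k <= d.+1)%N].
Proof. by []. Qed.

(** Generators have positive degree, so each letter consumes degree and fuel bounded below by the
    degree is enough. *)
Lemma mem_words j0 n w : all (fun k => (k < 17) && (k != j0))%N w ->
  (sumn (map gdeg w) <= n)%N -> w \in words j0 n (sumn (map gdeg w)).
Proof.
elim: n w => [|n IHn] [|k w]; rewrite ?map_cons ?[sumn (_ :: _)]/=; try by [].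
  by case/andP=> /andP[/gdegP [+ _]] _ _; rewrite leqn0 addn_eq0; case: (gdeg k).
case/andP=> /andP[k17 kj0] wj0 wn; have [gk _] := gdegP k17.
case def_d: (gdeg k + sumn _)%N => [|d]; first by case: (gdeg k) gk def_d.
rewrite words_S -def_d; apply/flatten_mapP; exists k; last first.
  by apply/map_f; rewrite addKn; apply: IHn => //; lia.
by rewrite mem_filter kj0 leq_addr mem_iota.
Qed.

Lemma wdeg_zword w : all (fun k => k < 17)%N w ->
  wdeg (fun _ => 1%N) (zword w) = Some (sumn (map gdeg w)).
Proof. by elim: w => //= k w IHw /andP[/gdegP[_ ->] /IHw ->]. Qed.

Lemma separatesP j : separates (val (j : 'I_17)).
Proof. by have /allP := all_separates; apply; rewrite mem_iota ltn_ord. Qed.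

Lemma minimality (j0 : 'I_17) : ~ generates_invariants (fun k : 'I_16 => gelt (lift j0 k)).
Proof.
move=> /(_ _ (gelt_inv j0)) [p /op_sound gp].
have /and3P [/allP lw /eqP lg /allP ld] := separatesP j0.
set l := nth [::] separators j0 in lw lg ld.
have /eqP := gp (fun m => emb (coef l m)) (0, 0, 0, 0, 0, 0)%N.
rewrite -tr_zg op_val lg op_words ?embE ?mul0r ?addr0 ?oner_eq0 // => w.
pose wn := [seq val (lift j0 k) | k <- w].
have -> : tword (fun k : 'I_16 => gelt (lift j0 k)) w = tr (zword wn).
  rewrite /wn; elim: (w) => [|k w' IHw] //=; by rewrite -IHw -tr_zg.
have wn17 : all (fun k => (k < 17) && (k != j0))%N wn.
  by apply/allP=> _ /mapP[k _ ->]; rewrite ltn_ord eq_sym neq_lift.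
have wn17' : all (fun k => k < 17)%N wn by apply: sub_all wn17 => k /andP[].
have emb0 : emb (0, 0) = 0 by rewrite embE mul0r addr0.
(* Words of the degree of the dropped generator belong to the list checked by computation; the
   others have no coefficient in the support of the functional. *)
have [wd|wd] := eqVneq (sumn (map gdeg wn)) (gdeg j0).
  by rewrite op_val (eqP (lw wn _)) // -{2}wd mem_words // wd.
apply: op_wdeg (wdeg_zword wn17') _ => m /= md.
suff -> : coef l m = (0, 0) by [].
elim: (l) ld => //= cm l' IHl ld; rewrite IHl; last first.
  by move=> cm' cm'l; apply: ld; rewrite inE cm'l orbT.
case: eqP => // mcm; case/eqP: wd.
by have /eqP := ld cm (mem_head _ _); rewrite -mcm md.
Qed.

(** * The Reynolds operator *)

Notation B := (quot B_rel).
Notation toB := (@cls 'I_6 B_rel).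
Notation kB := (@qconst 'I_6 B_rel).
Notation monB := (mon (fun v => toB (TV v))).

Lemma toBD t u : toB (TAdd t u) = toB t + toB u. Proof. by rewrite -!eval_cls. Qed.
Lemma toBM t u : toB (TMul t u) = toB t * toB u. Proof. by rewrite -!eval_cls. Qed.
Lemma toBN t : toB (TNeg t) = - toB t. Proof. by rewrite -!eval_cls eval_neg. Qed.

Lemma monBM m v : monB m * toB (TV v) = kB (imag ^+ (mulv m v).1) * monB (mulv m v).2.
Proof. by apply: (@monM _ kB); [apply: qconst_central | apply: quot_rel]. Qed.

Lemma Dact_add g t u : Dact g (TAdd t u) = TAdd (Dact g t) (Dact g u).
Proof.
have iterD f n v w : iter n (@subst 'I_6 'I_6 f) (TAdd v w) =
    TAdd (iter n (subst f) v) (iter n (subst f) w) by elim: n => //= n ->.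
by rewrite /Dact /act_r /act_s !iterD.
Qed.

Lemma Dact_mul g t u : Dact g (TMul t u) = TMul (Dact g t) (Dact g u).
Proof.
have iterM f n v w : iter n (@subst 'I_6 'I_6 f) (TMul v w) =
    TMul (iter n (subst f) v) (iter n (subst f) w) by elim: n => //= n ->.
by rewrite /Dact /act_r /act_s !iterM.
Qed.

Lemma Dact_const g c : Dact g (TC c) = TC c.
Proof.
have iterC f n : iter n (@subst 'I_6 'I_6 f) (TC c) = TC c by elim: n => //= n ->.
by rewrite /Dact /act_r /act_s !iterC.
Qed.

(** The Reynolds operator without its factor 1/8, which keeps coefficients Gaussian integers;
    [generation_of_mono] divides by 8. *)
Definition Rey (t : term 'I_6) : B := \sum_(g <- group_elts) toB (Dact g t).

Lemma Rey_eqB t u : eqB t u -> Rey t = Rey u.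
Proof. by move=> tu; apply: eq_bigr => g _; apply/clsP/Dact_sound. Qed.

Lemma Rey_add t u : Rey (TAdd t u) = Rey t + Rey u.
Proof. by rewrite -big_split; apply: eq_bigr => g _; rewrite Dact_add toBD. Qed.

Lemma Rey_scale c t : Rey (TMul (TC c) t) = kB c * Rey t.
Proof.
by rewrite mulr_sumr; apply: eq_bigr => g _; rewrite Dact_mul Dact_const toBM.
Qed.

Lemma group_eltsP g : g \in group_elts -> exists (a : 'I_4) (b : bool), g = (val a, b).
Proof.
case/allpairsP=> -[a b] []; rewrite mem_iota => /andP[_ a4] _ ->.
by exists (Ordinal a4), b.
Qed.

(** Group elements act multiplicatively and fix [u]. This linearity over invariants lets generators
    be split off a monomial under [Rey]. *)
Lemma Rey_mul_inv t u : Binv u -> Rey (TMul t u) = Rey t * toB u.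
Proof.
case=> _ uinv; rewrite mulr_suml [LHS]big_seq_cond [RHS]big_seq_cond.
apply: eq_bigr => g; rewrite andbT => /group_eltsP[a [b ->]].
by rewrite Dact_mul toBM (iffRL (clsP _ _ _) (uinv a b)).
Qed.

Lemma Rey_inv t : Binv t -> Rey t = 8%:R * toB t.
Proof.
case=> _ tinv; have -> : Rey t = \sum_(g <- group_elts) toB t.
  rewrite /Rey [LHS]big_seq_cond [RHS]big_seq_cond; apply: eq_bigr => g.
  by rewrite andbT => /group_eltsP[a [b ->]]; rewrite (iffRL (clsP _ _ _) (tinv a b)).
by rewrite big_const_seq count_predT iter_addr addr0 mulr_natl.
Qed.

Definition in_gen (q : B) : Prop := exists p : term 'I_17, q = toB (subst gelt p).

Lemma in_gen_const c : in_gen (kB c). Proof. by exists (TC c). Qed.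
Lemma in_gen_gelt j : in_gen (toB (gelt j)). Proof. by exists (TV j). Qed.
Lemma in_gen_add q r : in_gen q -> in_gen r -> in_gen (q + r).
Proof. by move=> [p ->] [p' ->]; exists (TAdd p p'); rewrite toBD. Qed.
Lemma in_gen_mul q r : in_gen q -> in_gen r -> in_gen (q * r).
Proof. by move=> [p ->] [p' ->]; exists (TMul p p'); rewrite toBM. Qed.
Lemma in_gen_sub q r : in_gen q -> in_gen r -> in_gen (q - r).
Proof.
move=> qS rS; rewrite -mulN1r -(rmorphN1 kB).
by apply: in_gen_add qS (in_gen_mul (in_gen_const _) rS).
Qed.

Lemma in_gen_zt (c : zt nat) : in_gen (toB (tr (zsubst zgn c))).
Proof.
elim: c => [g|j|a aS b bS|a aS b bS] /=; first exact: in_gen_const.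
- have [j17|j17] := ltnP j 17; first by rewrite (tr_zg (Ordinal j17)); apply: in_gen_gelt.
  by rewrite /zgn nth_default //; apply: in_gen_const.
- by rewrite toBD; apply: in_gen_add.
- by rewrite toBM; apply: in_gen_mul.
Qed.

(** * PBW monomials as terms, and their degrees in the group *)

Definition zmono (m : mono) : zt 'I_6 :=
  let: (a1, a2, b1, b2, c1, c2) := m in
  (zpow (ZV lx1) a1 * zpow (ZV lx2) a2 * zpow (ZV ly1) b1 * zpow (ZV ly2) b2 *
   zpow (ZV lz1) c1 * zpow (ZV lz2) c2)%zt.
Definition tmono (m : mono) : term 'I_6 := tr (zmono m).

Lemma eval_tmono (Q : pzRingType) (k : {rmorphism CC -> Q}) X m :
  eval k X (tmono m) = mon X m.
Proof.
have evX v n : eval k X (tr (zpow (ZV v) n)) = X v ^+ n.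
  by elim: n => [|n IHn] /=; rewrite ?rmorph1 ?exprS ?IHn.
by case: m => [[[[[a1 a2] b1] b2] c1] c2]; rewrite /= !evX.
Qed.

Lemma toB_tmono m : toB (tmono m) = monB m.
Proof. by rewrite -eval_cls eval_tmono. Qed.

(* In the group, [s^2 = (sr)^2 = r^2] is central of order 2, and [x2], [y2], [z2] have the
   degrees of [x1], [y1], [z1] times [r^2]. *)
Definition degm (m : mono) : grp :=
  let: (a1, a2, b1, b2, c1, c2) := m in
  let a := (a1 + a2)%N in let n := (b1 + b2 + c1 + c2)%N in
  (((a./2 + n./2 + a2 + b2 + c2).*2 + if odd n then 3 else 0) %% 4, odd a (+) odd n)%N.
Arguments degm : simpl never.

Lemma gmulA : associative gmul.
Proof.
move=> [a b] [c d] [e f]; rewrite /gmul; congr (_, _); last by case: b d f => [] [] [].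
by case: b d f => [] [] [] /=; lia.
Qed.

Lemma mod4 p q x y : (x + p * 4 = y + q * 4)%N -> x = y %[mod 4].
Proof. by move=> xy; rewrite -(modnMDl p x) -(modnMDl q y) addnC xy addnC. Qed.

Lemma degm_mulv m v : degm (mulv m v).2 = gmul (degm m) (gen_deg v).
Proof.
case: m => [[[[[a1 a2] b1] b2] c1] c2].
have oE : odd b1 (+) odd b2 (+) odd c1 (+) odd c2 = odd (b1 + b2 + c1 + c2) by rewrite !oddD.
have sE : (a1.+1 + a2 = (a1 + a2).+1)%N * (a1 + a2.+1 = (a1 + a2).+1)%N *
    (b1.+1 + b2 + c1 + c2 = (b1 + b2 + c1 + c2).+1)%N *
    (b1 + b2.+1 + c1 + c2 = (b1 + b2 + c1 + c2).+1)%N *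
    (b1 + b2 + c1.+1 + c2 = (b1 + b2 + c1 + c2).+1)%N *
    (b1 + b2 + c1 + c2.+1 = (b1 + b2 + c1 + c2).+1)%N by rewrite !(addSn, addnS).
elim/letterP: v; rewrite /mulv /= ?oE.
all: case oA: (odd (a1 + a2)); case oN: (odd (b1 + b2 + c1 + c2)).
all: rewrite /degm /gmul /gen_deg /= ?sE /= ?uphalf_half ?oA ?oN /=; congr (_, _).
(* With the parities fixed, the halves become free variables, and each congruence modulo 4 turns
   into a linear equality with the right multiples of 4 on both sides. *)
all: move: (a1 + a2)./2 (b1 + b2 + c1 + c2)./2 => {oA oN oE sE} A N; rewrite -!addnA ?modnDml.
all: first [by [] | by apply: (@mod4 0 0); lia | by apply: (@mod4 0 1); lia
           | by apply: (@mod4 1 0); lia | by apply: (@mod4 2 0); lia | by apply: (@mod4 3 0); lia].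
Qed.

Definition lin (p : seq (CC * mono)) : B := \sum_(cm <- p) kB cm.1 * monB cm.2.

(** Stated for multiplication of a combination of degree [h], so that a product is two successive
    multiplications. The bound on [h.1] ensures that [gmul] by [g_e] returns [h] itself, since
    [gmul] reduces modulo 4. *)
Lemma homog_lin g u : homog g u -> forall h p, (h.1 < 4)%N ->
  all (fun cm => degm cm.2 == h) p ->
  exists2 p', lin p * toB u = lin p' & all (fun cm => degm cm.2 == gmul h g) p'.
Proof.
elim=> {g u} [c|v|g t u _ IHt _ IHu|g g' t u _ IHt _ IHu] [h1 h2] p h4 ph.
- exists [seq (cm.1 * c, cm.2) | cm <- p].
    rewrite /lin big_map mulr_suml; apply: eq_bigr => cm _.
    by rewrite rmorphM -!mulrA [_ * toB (TC c)](esym (qconst_central c _)).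
  rewrite all_map; apply: sub_all ph => cm /= /eqP ->.
  by rewrite /gmul; case: (h2); rewrite /= ?muln0 !addn0 modn_small.
- exists [seq (cm.1 * imag ^+ (mulv cm.2 v).1, (mulv cm.2 v).2) | cm <- p].
    rewrite /lin big_map mulr_suml; apply: eq_bigr => cm _.
    by rewrite -mulrA monBM rmorphM mulrA.
  by rewrite all_map; apply: sub_all ph => cm /= /eqP; rewrite degm_mulv => ->.
- have [p1 e1 d1] := IHt _ _ h4 ph; have [p2 e2 d2] := IHu _ _ h4 ph.
  exists (p1 ++ p2); last by rewrite all_cat d1.
  by rewrite toBD mulrDr e1 e2 /lin big_cat.
- have [p1 e1 d1] := IHt _ _ h4 ph.
  have h4' : ((gmul (h1, h2) g).1 < 4)%N by case: (g) => a b; rewrite ltn_mod.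
  have [p2 e2 d2] := IHu _ _ h4' d1.
  by exists p2; [rewrite toBM mulrA e1 | rewrite gmulA].
Qed.

Lemma homog_e_span u : homog g_e u -> exists2 p, toB u = lin p & all (fun cm => degm cm.2 == g_e) p.
Proof.
move=> /homog_lin - /(_ g_e [:: (1, (0, 0, 0, 0, 0, 0)%N)] isT isT) [p pe dp].
by exists p => //; rewrite -pe /lin big_seq1 /= !expr0 rmorph1 !mulr1 mul1r.
Qed.

Definition lint (p : seq (CC * mono)) : term 'I_6 :=
  foldr (fun cm => TAdd (TMul (TC cm.1) (tmono cm.2))) (TC 0) p.

Lemma toB_lint p : toB (lint p) = lin p.
Proof.
elim: p => [|cm p IHp] /=; first by rewrite /lin big_nil -(rmorph0 kB).
by rewrite toBD toBM toB_tmono IHp /lin big_cons.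
Qed.

Lemma in_gen_Rey_lint p :
  (forall m, degm m = g_e -> in_gen (Rey (tmono m))) ->
  all (fun cm => degm cm.2 == g_e) p -> in_gen (Rey (lint p)).
Proof.
move=> mS; elim: p => [_|cm p IHp /= /andP[/eqP cme /IHp pS]].
  rewrite /Rey; apply: big_ind => [||g _]; first by rewrite -(rmorph0 kB); apply: in_gen_const.
    exact: in_gen_add.
  by rewrite Dact_const; apply: in_gen_const.
rewrite Rey_add Rey_scale; apply: in_gen_add pS.
by apply: in_gen_mul (mS _ cme); apply: in_gen_const.
Qed.

(** An invariant equals a combination of monomials of degree e, and [Rey] multiplies it by 8, which
    is invertible. *)
Lemma generation_of_mono :
  (forall m, degm m = g_e -> in_gen (Rey (tmono m))) -> generates_invariants gelt.
Proof.
move=> mS t tinv; have [[u [tu ue]] _] := tinv.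
have [p up pe] := homog_e_span ue.
have tp : eqB t (lint p) by apply: ae_trans tu _; apply/clsP; rewrite toB_lint.
have := in_gen_Rey_lint mS pe; rewrite -(Rey_eqB tp) (Rey_inv tinv) => tS.
suff [q tq] : in_gen (toB t) by exists q; apply/clsP.
have -> : toB t = kB 8%:R^-1 * (8%:R * toB t).
  rewrite mulrA -(rmorph_nat kB) -rmorphM mulVf ?rmorph1 ?mul1r //.
  by rewrite (pnatr_eq0 (Rdefinitions.R)[i]).
by apply: in_gen_mul tS; apply: in_gen_const.
Qed.

(** This is the effect of r^2, which negates x and z letters and fixes y letters: the sign is
    (-1)^(a1+a2+c1+c2). *)
Lemma mon_neg (Q : pzRingType) (X X' : 'I_6 -> Q) a1 a2 b1 b2 c1 c2 :
  ~~ odd (a1 + a2) -> odd (c1 + c2) ->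
  X' lx1 = - X lx1 -> X' lx2 = - X lx2 -> X' ly1 = X ly1 -> X' ly2 = X ly2 ->
  X' lz1 = - X lz1 -> X' lz2 = - X lz2 ->
  mon X' (a1, a2, b1, b2, c1, c2) = - mon X (a1, a2, b1, b2, c1, c2).
Proof.
move=> oa oc; rewrite /mon => -> -> -> -> -> ->.
have aE : odd a1 = odd a2 by move: oa; rewrite oddD; do 2!case: odd.
have cE : odd c1 = ~~ odd c2 by move: oc; rewrite oddD; do 2!case: odd.
rewrite !(exprNn (X _)) -(signr_odd _ a1) -(signr_odd _ a2) -(signr_odd _ c1) -(signr_odd _ c2) aE cE.
by case: (odd a2); case: (odd c2); rewrite /= ?expr0 ?expr1 ?mul1r ?mulN1r
   ?(mulrN, mulNr, opprK).
Qed.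

(* [r^2] acts on a monomial by a sign, and [Rey] pairs [g] with [r^2 g]. *)
Lemma Rey_odd a1 a2 b1 b2 c1 c2 : ~~ odd (a1 + a2) -> odd (c1 + c2) ->
  Rey (tmono (a1, a2, b1, b2, c1, c2)) = 0.
Proof.
set m := (a1, a2, b1, b2, c1, c2) => oa oc.
have act2 : eqB (act_r (act_r (tmono m))) (TNeg (tmono m)).
  apply/clsP; rewrite toBN -eval_cls !eval_subst eval_tmono toB_tmono.
  have sgn v : zeqb (zsubst zact_r (zact_r v))
      (if v \in [:: ly1; ly2] then ZV v else zneg (ZV v)).
    by elim/letterP: v; vm_compute.
  have actE v : eval kB (fun v => eval kB (fun v => toB (TV v)) (act_r_gen v)) (act_r_gen v) =
      if v \in [:: ly1; ly2] then toB (TV v) else - toB (TV v).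
    have rE w : tr (zact_r w) = act_r_gen w by elim/letterP: w.
    rewrite -eval_subst eval_cls -rE -(tr_subst _ rE) (iffRL (clsP _ _ _) (zeqb_sound (sgn v))).
    by case: (v \in _) => //; rewrite -toBN.
  by apply: mon_neg.
have D2 a b : toB (Dact (a.+2, b) (tmono m)) = - toB (Dact (a, b) (tmono m)).
  have -> : Dact (a.+2, b) (tmono m) = Dact (a, b) (act_r (act_r (tmono m))).
    by rewrite /Dact /= -!iterSr.
  by rewrite (iffRL (clsP _ _ _) (Dact_sound _ act2)) Dact_mul Dact_const toBN.
have gE : group_elts = [:: (0, false); (0, true); (1, false); (1, true);
  (2, false); (2, true); (3, false); (3, true)]%N by [].
rewrite /Rey gE !big_cons big_nil addr0 !(D2 0, D2 1) -!opprD !addrA.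
by rewrite subrr.
Qed.

(** * Reduction to finitely many monomials *)

(* [adm m] says that [m] has degree [e] and an even number of letters of each kind. *)
Definition adm (m : mono) : bool :=
  let: (a1, a2, b1, b2, c1, c2) := m in
  [&& ~~ odd (a1 + a2), ~~ odd (b1 + b2), ~~ odd (c1 + c2) &
      ~~ odd ((a1 + a2 + b1 + b2 + c1 + c2)./2 + a2 + b2 + c2)]%N.

(** Degree e makes the number of x's even, and that of y's and z's together. If the y's and the z's
    are both odd in number, [Rey_odd] applies. *)
Lemma degm_adm m : degm m = g_e ->
  adm m \/ Rey (tmono m) = 0.
Proof.
case: m => [[[[[a1 a2] b1] b2] c1] c2]; rewrite /degm => -[K oan].
(* An odd count would add 3 to an even number, which is never 0 modulo 4. *)
have /negbTE oN : ~~ odd (b1 + b2 + c1 + c2).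
  by move: K; case: odd => //; rewrite -muln2; lia.
move: K oan; rewrite oN addbF addn0 => K oa.
case oc: (odd (c1 + c2)); first by right; apply: Rey_odd; rewrite ?oa.
left; have ob : odd (b1 + b2) = false.
  by move: oN; rewrite -addnA oddD oc addbF.
rewrite /adm oa ob oc /=.
have -> : ((a1 + a2 + b1 + b2 + c1 + c2)./2 = (a1 + a2)./2 + (b1 + b2 + c1 + c2)./2)%N.
  by rewrite (_ : a1 + a2 + b1 + b2 + c1 + c2 = (a1 + a2) + (b1 + b2 + c1 + c2))%N ?halfD ?oa ?addnA.
move: K; rewrite -muln2; move: (_ + _ + a2 + b2 + c2)%N => K.
by lia.
Qed.

Lemma Rey_red m m' m'' d c (j : 'I_17) :
  monB m = kB d * (monB m' * toB (gelt j)) + kB c * monB m'' ->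
  in_gen (Rey (tmono m')) -> in_gen (Rey (tmono m'')) -> in_gen (Rey (tmono m)).
Proof.
move=> mE m'S m''S.
have /Rey_eqB -> : eqB (tmono m) (TAdd (TMul (TC d) (TMul (tmono m') (gelt j)))
    (TMul (TC c) (tmono m''))).
  by apply/clsP; rewrite toBD !toBM !toB_tmono.
rewrite Rey_add !Rey_scale Rey_mul_inv; last exact: gelt_inv.
apply: in_gen_add; apply: in_gen_mul => //; try exact: in_gen_const.
by apply: in_gen_mul => //; apply: in_gen_gelt.
Qed.

Lemma Rey_red1 m m' d (j : 'I_17) :
  monB m = kB d * (monB m' * toB (gelt j)) ->
  in_gen (Rey (tmono m')) -> in_gen (Rey (tmono m)).
Proof.
move=> mE m'S; apply: (@Rey_red m m' m' d 0 j) => //.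
by rewrite mE rmorph0 mul0r addr0.
Qed.

(** * Splitting generators off monomials *)

Definition zlw (s : seq 'I_6) : zt 'I_6 := foldr (fun v => ZMul (ZV v)) (ZC (1, 0)) s.

Fixpoint mulw (m : mono) (s : seq 'I_6) : nat * mono :=
  if s is v :: s' then
    ((mulv m v).1 + (mulw (mulv m v).2 s').1, (mulw (mulv m v).2 s').2)%N
  else (0%N, m).

Lemma monBMw m s : monB m * toB (tr (zlw s)) = kB (imag ^+ (mulw m s).1) * monB (mulw m s).2.
Proof.
elim: s m => [|v s IHs] m; first by rewrite /= expr0 rmorph1 mul1r -[RHS]mulr1 -(rmorph1 kB).
by rewrite toBM mulrA monBM -mulrA IHs mulrA -rmorphM -exprD.
Qed.

Lemma zg_word (j : 'I_17) s : zeqb (zg j) (zlw s) -> toB (gelt j) = toB (tr (zlw s)).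
Proof. by rewrite -tr_zg => /zeqb_sound /clsP. Qed.

Lemma zg_words (j : 'I_17) s s' : zeqb (zg j) (ZAdd (zlw s) (zlw s')) ->
  toB (gelt j) = toB (tr (zlw s)) + toB (tr (zlw s')).
Proof. by rewrite -tr_zg -toBD => /zeqb_sound /clsP. Qed.

Lemma imag_mod4 q n : n = (4 * q)%N -> imag ^+ n = 1.
Proof. by move=> ->; apply: imag_exp4. Qed.

Arguments mon : simpl never.

Section Divide.
Variables a1 a2 b1 b2 c1 c2 : nat.
Let m : mono := (a1, a2, b1, b2, c1, c2).

Lemma div_g1 : monB (a1, a2, b1.+1, b2.+1, c1, c2) =
  kB 1 * (monB m * toB (gelt (@Ordinal 17 0 isT))).
Proof.
rewrite (@zg_word _ [:: ly1; ly2]) // monBMw /=.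
by rewrite expr0 rmorph1 !mul1r.
Qed.

(** Moving z1 past z2^c2 costs (-1)^c2, which the scalar i^(2 c2) cancels. *)
Lemma div_g2 : monB (a1, a2, b1, b2, c1.+1, c2.+1) =
  kB (imag ^+ (2 * c2)) * (monB m * toB (gelt (@Ordinal 17 1 isT))).
Proof.
rewrite (@zg_word _ [:: lz1; lz2]) // monBMw /=.
by rewrite mulrA -rmorphM -exprD (@imag_mod4 c2) ?rmorph1 ?mul1r //; lia.
Qed.

Lemma sum_g5 : monB (a1, a2, b1.+4, b2, c1, c2) =
  kB 1 * (monB m * toB (gelt (@Ordinal 17 4 isT))) +
  kB (-1) * monB (a1, a2, b1, b2.+4, c1, c2).
Proof.
rewrite (@zg_words _ (nseq 4 ly1) (nseq 4 ly2)) // mulrDr !monBMw /=.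
by rewrite expr0 rmorph1 !mul1r rmorphN1 mulN1r addrK.
Qed.

Lemma sum_g6 : monB (a1, a2, b1, b2, c1.+4, c2) =
  kB 1 * (monB m * toB (gelt (@Ordinal 17 5 isT))) +
  kB (-1) * monB (a1, a2, b1, b2, c1, c2.+4).
Proof.
rewrite (@zg_words _ (nseq 4 lz1) (nseq 4 lz2)) // mulrDr !monBMw /=.
rewrite (@imag_mod4 (2 * c2)%N); last by lia.
by rewrite expr0 rmorph1 !mul1r rmorphN1 mulN1r addrK.
Qed.

Hypotheses (ob : ~~ odd (b1 + b2)) (oc : ~~ odd (c1 + c2)).

Let w := (c2 + 3 * c1 + 2 * b2)%N.

(** With evenly many y's and z's, an x passes all of them without changing its index, at cost i^w.
    Four x's therefore cost 1, as needed for g_3 and g_4. *)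
Lemma mulw_x s : all (mem [:: lx1; lx2]) s ->
  mulw m s = (size s * w, (a1 + count_mem lx1 s, a2 + count_mem lx2 s, b1, b2, c1, c2))%N.
Proof.
have o_even : odd b1 (+) odd b2 (+) odd c1 (+) odd c2 = false.
  by move: ob oc; rewrite !oddD; do 4!case: odd.
rewrite /m; elim: s a1 a2 => [|v s IHs] a a' /=; first by rewrite !addn0.
rewrite !inE => /andP[/orP[]/eqP-> sx]; rewrite /mulv /= o_even IHs //=.
  by rewrite mulSn addSnnS.
by rewrite mulSn addSnnS.
Qed.

Lemma div_g3 : monB (a1.+2, a2.+2, b1, b2, c1, c2) =
  kB 1 * (monB m * toB (gelt (@Ordinal 17 2 isT))).
Proof.
rewrite (@zg_word _ [:: lx1; lx1; lx2; lx2]) // monBMw mulw_x //=.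
by rewrite imag_exp4 rmorph1 !mul1r !addn2.
Qed.

Lemma sum_g4 : monB (a1.+4, a2, b1, b2, c1, c2) =
  kB 1 * (monB m * toB (gelt (@Ordinal 17 3 isT))) +
  kB (-1) * monB (a1, a2.+4, b1, b2, c1, c2).
Proof.
rewrite (@zg_words _ (nseq 4 lx1) (nseq 4 lx2)) // mulrDr !monBMw !mulw_x //=.
by rewrite !imag_exp4 rmorph1 !mul1r rmorphN1 mulN1r !addn0 !addn4 addrK.
Qed.
End Divide.

Definition good (m : mono) : Prop := in_gen (Rey (tmono m)).

(** The hypothesis says that [m1] + [m2] is [m] times a generator, so [m1] and [m2] are
    interchangeable once [m] is good. *)
Lemma good_sum m m1 m2 (j : 'I_17) :
  monB m1 = kB 1 * (monB m * toB (gelt j)) + kB (-1) * monB m2 ->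
  good m -> (good m1 <-> good m2).
Proof.
move=> e gm; split; last exact: Rey_red e gm.
apply: (@Rey_red _ m m1 1 (-1) j) => //.
by rewrite e rmorphN1 !mulN1r opprB addrC subrK.
Qed.

Section Steps.
Variables a1 a2 b1 b2 c1 c2 : nat.
Hypothesis m_good : good (a1, a2, b1, b2, c1, c2).

Lemma good_y : good (a1, a2, b1.+1, b2.+1, c1, c2).
Proof. exact: Rey_red1 (div_g1 _ _ _ _ _ _) m_good. Qed.
Lemma good_z : good (a1, a2, b1, b2, c1.+1, c2.+1).
Proof. exact: Rey_red1 (div_g2 _ _ _ _ _ _) m_good. Qed.
Lemma good_x : ~~ odd (b1 + b2) -> ~~ odd (c1 + c2) -> good (a1.+2, a2.+2, b1, b2, c1, c2).
Proof. by move=> ob oc; apply: Rey_red1 (div_g3 _ _ ob oc) m_good. Qed.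
Lemma good_y4 : good (a1, a2, b1.+4, b2, c1, c2) <-> good (a1, a2, b1, b2.+4, c1, c2).
Proof. exact: good_sum (sum_g5 _ _ _ _ _ _) m_good. Qed.
Lemma good_z4 : good (a1, a2, b1, b2, c1.+4, c2) <-> good (a1, a2, b1, b2, c1, c2.+4).
Proof. exact: good_sum (sum_g6 _ _ _ _ _ _) m_good. Qed.
Lemma good_x4 : ~~ odd (b1 + b2) -> ~~ odd (c1 + c2) ->
  good (a1.+4, a2, b1, b2, c1, c2) <-> good (a1, a2.+4, b1, b2, c1, c2).
Proof. by move=> ob oc; apply: good_sum (sum_g4 _ _ ob oc) m_good. Qed.
End Steps.

(* Up to a scalar, the nonzero Reynolds images of the irreducible monomials, found by linear
   algebra in each tridegree; the generators are numbered from 0. *)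
Definition candidates : seq (zt nat) :=
  let w s := foldr (fun j => ZMul (ZV j)) (ZC (1, 0)) s in
  [seq w s | s <- [:: [::]; [:: 3]; [:: 4]; [:: 5]; [:: 6]; [:: 7]; [:: 8]; [:: 9]; [:: 10];
     [:: 11]; [:: 12]; [:: 13]; [:: 14]; [:: 15]; [:: 16]; [:: 3; 4]; [:: 3; 5]; [:: 3; 11];
     [:: 3; 12]; [:: 3; 16]; [:: 4; 8]; [:: 5; 8]; [:: 8; 16]]] ++
  [:: w [:: 3; 16] - w [:: 3; 4; 5]; w [:: 6; 11] + w [:: 0; 0; 10];
      w [:: 7; 11] - w [:: 1; 1; 9]; w [:: 8; 16] - w [:: 4; 5; 8];
      w [:: 13] + w [:: 6; 7]; w [:: 14] + w [:: 4; 7]; w [:: 15] - w [:: 5; 6];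
      w [:: 16] - w [:: 4; 5]; w [:: 4; 10] - w [:: 6; 11] - w [:: 6; 12];
      w [:: 5; 9] - w [:: 7; 11] - w [:: 7; 12]]%zt.

Definition Rey_poly (m : mono) : poly :=
  flatten [seq ev (zDact g (zmono m)) pone | g <- group_elts].

Definition cand_polys : seq poly := [seq ev (zsubst zgn c) pone | c <- candidates].

(** The scalar [z] is minus the ratio of the Reynolds image to the candidate; -8 serves the monomial
    1, whose image is 8. *)
Definition good_check (cs : seq poly) (m : mono) : bool :=
  let r := Rey_poly m in
  is0 r || has (fun c => has (fun z => is0 (r ++ ev (ZC (z, 0)) c))
    [:: 1; -1; 2; -2; 4; -4; -8]) cs.

Definition irreducible_mono (m : mono) : bool :=
  let: (a1, a2, b1, b2, c1, c2) := m in
  [&& ~~ ((1 < a1) && (1 < a2)), ~~ ((0 < b1) && (0 < b2)) & ~~ ((0 < c1) && (0 < c2))]%N.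

(** The exponents stop at 5 for x and at 4 for y and z: beyond that, a fourth power can be traded
    and still leave the two x's, or the one y or z, needed to split off g_3, g_1 or g_2. *)
Definition box_check : bool :=
  let cs := cand_polys in
  all (fun a1 => all (fun a2 => all (fun b1 => all (fun b2 => all (fun c1 => all (fun c2 =>
    let m := (a1, a2, b1, b2, c1, c2) in
    if irreducible_mono m && adm m then good_check cs m else true)
  (iota 0 5)) (iota 0 5)) (iota 0 5)) (iota 0 5)) (iota 0 6)) (iota 0 6).

Lemma box_ok : box_check. Proof. by vm_compute. Qed.

Lemma good_checkP m : good_check cand_polys m -> good m.
Proof.
have kc := @qconst_central 'I_6 B_rel; have rc := @quot_rel 'I_6 B_rel.
have evE t : den kB monB (ev t pone) = toB (tr t).
  by rewrite (den_ev kc rc) den_one mul1r eval_cls.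
rewrite /good; have -> : Rey (tmono m) = den kB monB (Rey_poly m).
  rewrite /Rey_poly /den big_flatten big_map; apply: eq_bigr => g _.
  by rewrite -tr_zDact -evE.
rewrite /good_check /cand_polys has_map.
case/orP=> [r0 | /(has_nthP (ZC (0, 0))) [i _ /hasP[z _ rz0]]].
  by rewrite is0P // -(rmorph0 kB); apply: in_gen_const.
have /eqP := is0P kB monB rz0.
have -> p q : den kB monB (p ++ q) = den kB monB p + den kB monB q by rewrite /den big_cat.
rewrite (den_ev kc rc) evE addr_eq0 => /eqP ->; rewrite -sub0r -(rmorph0 kB).
by apply: in_gen_sub (in_gen_const _) (in_gen_mul (in_gen_zt _) (in_gen_const _)).
Qed.

Lemma good_irreducible a1 a2 b1 b2 c1 c2 : let m := (a1, a2, b1, b2, c1, c2) in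
  irreducible_mono m -> adm m ->
  (a1 < 6)%N -> (a2 < 6)%N -> (b1 < 5)%N -> (b2 < 5)%N -> (c1 < 5)%N -> (c2 < 5)%N -> good m.
Proof.
move=> m mi ma a1s a2s b1s b2s c1s c2s.
have io n k : (n < k)%N -> n \in iota 0 k by rewrite mem_iota.
have := box_ok; rewrite /box_check.
move=> /allP /(_ _ (io _ _ a1s)) /allP /(_ _ (io _ _ a2s)) /allP /(_ _ (io _ _ b1s)).
move=> /allP /(_ _ (io _ _ b2s)) /allP /(_ _ (io _ _ c1s)) /allP /(_ _ (io _ _ c2s)).
by rewrite -/m mi ma => /good_checkP.
Qed.

(** Induction on the total degree. Splitting off a generator preserves [adm], and what survives all
    reductions lies in the finite box. *)
Lemma good_adm m : adm m -> good m.
Proof.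
have [n] := ubnP (mdeg m); elim: n m => // n IHn [[[[[a1 a2] b1] b2] c1] c2] mn am.
have [ob oc] : ~~ odd (b1 + b2) /\ ~~ odd (c1 + c2) by case/and4P: am.
have IH a1' a2' b1' b2' c1' c2' : adm (a1', a2', b1', b2', c1', c2') ->
    (a1' + a2' + b1' + b2' + c1' + c2' < a1 + a2 + b1 + b2 + c1 + c2)%N ->
    good (a1', a2', b1', b2', c1', c2').
  by move=> am' lt; apply: IHn => //; move: mn; rewrite /mdeg; lia.
move=> {n IHn mn}.
have [/andP[]|nb] := boolP ((0 < b1) && (0 < b2))%N.
  case: b1 b2 => [|b1] [|b2] // in IH am ob oc *; move=> _ _.
  by apply/good_y/IH; [move: am; rewrite /adm | ]; lia.
have [/andP[]|nc] := boolP ((0 < c1) && (0 < c2))%N.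
  case: c1 c2 => [|c1] [|c2] // in IH am ob oc nb *; move=> _ _.
  by apply/good_z/IH; [move: am; rewrite /adm | ]; lia.
have [/andP[]|na] := boolP ((1 < a1) && (1 < a2))%N.
  case: a1 a2 => [|[|a1]] [|[|a2]] // in IH am ob oc nb nc *; move=> _ _.
  by apply: good_x => //; apply: IH; [move: am; rewrite /adm | ]; lia.
have [|a1s] := leqP 6 a1.
  case: a1 => [|[|[|[|[|[|a1]]]]]] // in IH am ob oc nb nc na *; move=> _.
  (* Trading x1^4 for x2^4 leaves both x exponents at least 2, so g_3 can be split off
     afterwards. *)
  apply: (iffRL (good_x4 _ ob oc)); first by apply: IH; [move: am; rewrite /adm | ]; lia.
  by apply: good_x => //; apply: IH; [move: am; rewrite /adm | ]; lia.
have [|a2s] := leqP 6 a2.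
  case: a2 => [|[|[|[|[|[|a2]]]]]] // in IH am ob oc nb nc na *; move=> _.
  apply: (iffLR (good_x4 _ ob oc)); first by apply: IH; [move: am; rewrite /adm | ]; lia.
  by apply: good_x => //; apply: IH; [move: am; rewrite /adm | ]; lia.
have [|b1s] := leqP 5 b1.
  case: b1 => [|[|[|[|[|b1]]]]] // in IH am ob oc nb nc na *; move=> _.
  (* Here one y1 remains beside the new y2^4, which is enough for g_1. *)
  apply: (iffRL (good_y4 _)); first by apply: IH; [move: am; rewrite /adm | ]; lia.
  by apply/good_y/IH; [move: am; rewrite /adm | ]; lia.
have [|b2s] := leqP 5 b2.
  case: b2 => [|[|[|[|[|b2]]]]] // in IH am ob oc nb nc na *; move=> _.
  apply: (iffLR (good_y4 _)); first by apply: IH; [move: am; rewrite /adm | ]; lia.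
  by apply/good_y/IH; [move: am; rewrite /adm | ]; lia.
have [|c1s] := leqP 5 c1.
  case: c1 => [|[|[|[|[|c1]]]]] // in IH am ob oc nb nc na *; move=> _.
  apply: (iffRL (good_z4 _)); first by apply: IH; [move: am; rewrite /adm | ]; lia.
  by apply/good_z/IH; [move: am; rewrite /adm | ]; lia.
have [|c2s] := leqP 5 c2.
  case: c2 => [|[|[|[|[|c2]]]]] // in IH am ob oc nb nc na *; move=> _.
  apply: (iffLR (good_z4 _)); first by apply: IH; [move: am; rewrite /adm | ]; lia.
  by apply/good_z/IH; [move: am; rewrite /adm | ]; lia.
by apply: good_irreducible => //; rewrite /irreducible_mono na nb nc.
Qed.

Theorem mainTheorem11 :
  (* each g_j is Binv *)
  (forall j : 'I_17, Binv (gelt j)) /\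
  (* g_1, ..., g_17 generate B^{D(D_4)} as a C-algebra *)
  generates_invariants gelt /\
  (* minimality: dropping any one g_j, the rest no longer generate *)
  (forall j0 : 'I_17, ~ generates_invariants (fun k : 'I_16 => gelt (lift j0 k))).
Proof.
split; first exact: gelt_inv.
split; last exact: minimality.
apply: generation_of_mono => m /degm_adm[/good_adm // | ->].
by rewrite -(rmorph0 kB); apply: in_gen_const.
Qed.
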